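(* Let $p\in(0,1)$, let $D$ be the distribution with $D(1)=1-p$, $D(2)=p$, and let $\mathrm{Cap}(D)$ be the capacity (in nats per channel use) of the elementary duplication channel, i.e. the binary repeat channel with replication distribution $D$. For integers $y\ge 1$ and $i=1,2,3$ put $\Lambda_i(y)=\int_0^1 f_i(y,t)\,dt$, where $$f_1(y,t)=\frac{1-\frac{ty}{1+p}}{t\log(1-t)}-\frac{\left(\sqrt{(1+p)^2-4pt}-(1-p)\right)^y}{(2p)^y\,t\log(1-t)},$$ $$f_2(y,t)=\frac{1-\frac{typ}{1+p}}{t\log(1-t)}-\frac{\left(\sqrt{(1+p)^2-4p^2t}-(1-p)\right)^y}{(2p)^y\,t\log(1-t)},$$ $$f_3(y,t)=\frac{1-\frac{ty(1-p)}{1+p}}{t\log(1-t)}-\frac{\left(\sqrt{(1+p)^2-4p(1-p)t}-(1-p)\right)^y}{(2p)^y\,t\log(1-t)}.$$ For $q\in(0,1)$ let $y_0=y_0(q)$ be defined by $$\frac1{y_0}=\sum_{y=1}^\infty q^y e^{\Lambda_1(y)-\Lambda_2(y)-\Lambda_3(y)-yh(p)/(1+p)}<\infty,$$ and $$\mathbb{E}[Y^{(q)}]=\sum_{y=1}^\infty y_0\,y\,q^y e^{\Lambda_1(y)-\Lambda_2(y)-\Lambda_3(y)-yh(p)/(1+p)}.$$ Then $$\mathrm{Cap}(D)\le(1+p)\sup_{\mu\ge 1+p}\frac{\inf_{q\in(0,1)}(-\log y_0-\mu\log q)}{\mu}\le\sup_{q\in(0,1):\ \mathbb{E}[Y^{(q)}]\ge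 1+p}\frac{(1+p)(-\log y_0-\mathbb{E}[Y^{(q)}]\log q)}{\mathbb{E}[Y^{(q)}]}.$$
   Context: $\log$ is the natural logarithm and $h(p)=-p\log p-(1-p)\log(1-p)$; all information quantities are in nats. For a random variable $D$ supported on the non-negative integers, the repeat channel with replication distribution $D$ takes a bit string $x_1\cdots x_n\in\{0,1\}^n$ and outputs the string obtained by replacing each $x_i$ by $D_i$ consecutive copies of $x_i$, where $D_1,D_2,\dots$ are i.i.d. copies of $D$; the receiver sees only the concatenated output string. $\mathrm{Cap}(D)$ is its Shannon capacity per input bit, i.e. the supremum of rates of reliable communication, equal to $\lim_{n\to\infty}\frac1n\sup_{X^n}I(X^n;Y)$, where $X^n$ ranges over random $n$-bit inputs and $Y$ is the output string. $Y^{(q)}$ denotes the probability distribution on $\{1,2,\dots\}$ with mass $y_0q^y e^{\Lambda_1(y)-\Lambda_2(y)-\Lambda_3(y)-yh(p)/(1+p)}$ at $y$. *)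

(* Defs.v *)
From HB Require Import structures.
From mathcomp Require Import all_boot all_order all_algebra.
From mathcomp Require Import all_classical all_reals all_analysis.

Set Implicit Arguments.
Unset Strict Implicit.
Unset Printing Implicit Defensive.

Import Order.TTheory GRing.Theory Num.Theory.
Import numFieldNormedType.Exports.

Local Open Scope classical_set_scope.
Local Open Scope ring_scope.

Section RepeatChannel.
Context {R : realType}.

Definition repeat_output (n : nat) (x : n.-tuple bool) (d : n.-tuple nat)
    : seq bool :=
  flatten [seq nseq xd.2 xd.1 | xd <- zip x d].

(* A replication distribution is given by its mass function D : nat -> R; the
   replication counts are i.i.d., so the tuple d has mass \prod_(k <- d) D k. *)
Definition error_prob (D : nat -> R) (n M : nat)
    (enc : 'I_M -> n.-tuple bool) (dec : seq bool -> 'I_M) (m : 'I_M) : \bar R :=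
  \esum_(d in [set d : n.-tuple nat | dec (repeat_output (enc m) d) != m])
    (\prod_(k <- d) D k)%:E.

Definition avg_error_prob (D : nat -> R) (n M : nat)
    (enc : 'I_M -> n.-tuple bool) (dec : seq bool -> 'I_M) : \bar R :=
  ((\sum_(m < M) error_prob D enc dec m) / M%:R%:E)%E.

(* r (in nats per input bit) is a rate of reliable communication: for every
   eps > 0 and all large n there is a code of block length n with at least
   e ^ (n * r) messages and error probability at most eps. *)
Definition achievable_rate (D : nat -> R) (r : R) : Prop :=
  forall eps : R, 0 < eps -> \forall n \near \oo,
    exists (M : nat) (enc : 'I_M -> n.-tuple bool) (dec : seq bool -> 'I_M),
      expR (n%:R * r) <= M%:R /\ (avg_error_prob D enc dec <= eps%:E)%E.

Definition Cap (D : nat -> R) : \bar R :=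
  ereal_sup [set r%:E | r in [set r | achievable_rate D r]].

Definition duplication_dist (p : R) (k : nat) : R :=
  if k == 1%N then 1 - p else if k == 2%N then p else 0.

End RepeatChannel.

Section DuplicationBound.
Context {R : realType}.
Implicit Types (p q t : R) (y : nat).

Definition binary_entropy p : R := - p * ln p - (1 - p) * ln (1 - p).

Definition f1 p y t : R :=
  (1 - t * y%:R / (1 + p)) / (t * ln (1 - t))
  - (Num.sqrt ((1 + p) ^+ 2 - 4 * p * t) - (1 - p)) ^+ y
    / ((2 * p) ^+ y * t * ln (1 - t)).

Definition f2 p y t : R :=
  (1 - t * y%:R * p / (1 + p)) / (t * ln (1 - t))
  - (Num.sqrt ((1 + p) ^+ 2 - 4 * p ^+ 2 * t) - (1 - p)) ^+ y
    / ((2 * p) ^+ y * t * ln (1 - t)).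

Definition f3 p y t : R :=
  (1 - t * y%:R * (1 - p) / (1 + p)) / (t * ln (1 - t))
  - (Num.sqrt ((1 + p) ^+ 2 - 4 * p * (1 - p) * t) - (1 - p)) ^+ y
    / ((2 * p) ^+ y * t * ln (1 - t)).

(* The f_i are bounded on the open interval; at the endpoints, a null set, the
   divisions by zero return 0. *)
Definition Lambda (f : nat -> R -> R) y : R :=
  Rintegral lebesgue_measure `[0, 1]%classic (f y).

Definition weight p q y : R :=
  q ^+ y * expR (Lambda (f1 p) y - Lambda (f2 p) y - Lambda (f3 p) y
                 - y%:R * binary_entropy p / (1 + p)).

(* The series defining 1 / y_0, in the extended reals. *)
Definition inv_y0 p q : \bar R :=
  (\sum_(1 <= y <oo) (weight p q y)%:E)%E.

Definition y0 p q : R := (fine (inv_y0 p q))^-1.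

Definition mean_Y p q : R :=
  fine (\sum_(1 <= y <oo) (y0 p q * y%:R * weight p q y)%:E)%E.

End DuplicationBound.

(* Main.v *)
Require Import Defs.
From HB Require Import structures.
From mathcomp Require Import all_boot all_order all_algebra.
From mathcomp Require Import all_classical all_reals all_analysis.
From mathcomp Require Import measurable_realfun ring lra.

(* For integer x let Y_x = x + K with K binomial(x, p), the output length of an
   input run of length x. The number g = droot s solves (1 - p + p g) g = 1 - s,
   so E[g ^ Y_x] = (1 - s) ^ x, and with ln n! equal to the integral over (0, 1)
   of (1 - t n - (1 - t) ^ n) / (t ln (1 - t)) this gives
     E[Lambda_1 - Lambda_2 - Lambda_3](Y_x) = E[ln C(x, K)].
   Hence the divergence of Y_x from Y^(q) is exactly - ln y0 - (1 + p) x ln q.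
   Since no run is deleted, a codeword with R runs then has divergence
   - R ln y0 - (1 + p) n ln q from R independent copies of Y^(q), and Fano's
   inequality bounds the rate with mu = (1 + p) n / (mean number of runs).
   For the second inequality, choose q with E[Y^(q)] = mu: the weights are
   subexponential, so E[Y^(q)] is continuous in q; it tends to 1 at q = 0 and to
   infinity at q = 1, because the weights at q = 1 are not summable: their mean
   under Y_x is at least exp (- H(Y_x)) >= 1 / (x + 1), while by a renewal
   argument the laws of the Y_x add up to at most 1 at each point. *)

Set Implicit Arguments.
Unset Strict Implicit.
Unset Printing Implicit Defensive.
Import Order.TTheory GRing.Theory Num.Theory.
Import numFieldNormedType.Exports.
Local Open Scope classical_set_scope.
Local Open Scope ring_scope.

(** * Binomial means *)

(** The identity for Lambda holds only in the mean over K and says nothing direct about a single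
    [logweight y], while convergence of the series and continuity of the mean need a pointwise
    subexponential bound. It comes from comparing y with a mixture of the laws of Y_x and Y_{x+1}
    whose mean is exactly y: there the mean of [logweight] is a mixture of negated entropies, hence
    at most 0, and the comparison error is a Jensen gap integrated against a kernel with a t^-2
    singularity. In the converse, codewords have different numbers of runs, so no single product law
    serves all of them; the output is compared with the sum of the product laws over both first bits
    and all run counts up to n, which costs only a logarithm of n. The mean number of runs is fixed
    by the code before q is chosen, and this puts the infimum over q inside the supremum over mu. *)

Section BinomialMean.
Context {R : realType}.
Variable p : R.
Hypotheses (p_gt0 : 0 < p) (p_lt1 : p < 1).

Definition binmass n k : R := 'C(n, k)%:R * p ^+ k * (1 - p) ^+ (n - k).

Definition binmean n (G : nat -> R) : R := \sum_(k < n.+1) binmass n k * G k.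

Lemma eq_binmean n (F G : nat -> R) :
  (forall k, (k <= n)%N -> F k = G k) -> binmean n F = binmean n G.
Proof. by move=> FG; apply: eq_bigr => k _; rewrite FG // -ltnS. Qed.

Lemma binmass_gt0 n k : (k <= n)%N -> 0 < binmass n k.
Proof.
by move=> kn; rewrite /binmass !mulr_gt0 ?exprn_gt0 ?ltr0n ?bin_gt0 ?subr_gt0.
Qed.

Lemma le_binmean n (F G : nat -> R) :
  (forall k, (k <= n)%N -> F k <= G k) -> binmean n F <= binmean n G.
Proof.
move=> FG; apply: ler_sum => k _.
have kn : (k <= n)%N by rewrite -ltnS.
by rewrite ler_wpM2l ?FG // ltW // binmass_gt0.
Qed.

Lemma binmeanD n (F G : nat -> R) :
  binmean n (fun k => F k + G k) = binmean n F + binmean n G.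
Proof. by rewrite /binmean -big_split; apply: eq_bigr => k _; rewrite mulrDr. Qed.

Lemma binmeanZ n c (F : nat -> R) :
  binmean n (fun k => c * F k) = c * binmean n F.
Proof. by rewrite /binmean mulr_sumr; apply: eq_bigr => k _; rewrite mulrCA. Qed.

Lemma binmeanN n (F : nat -> R) : binmean n (fun k => - F k) = - binmean n F.
Proof. by rewrite /binmean -sumrN; apply: eq_bigr => k _; rewrite mulrN. Qed.

Lemma binmeanB n (F G : nat -> R) :
  binmean n (fun k => F k - G k) = binmean n F - binmean n G.
Proof. by rewrite binmeanD binmeanN. Qed.

Lemma binmean0 G : binmean 0 G = G 0.
Proof. by rewrite /binmean big_ord1 /binmass bin0 !expr0 !mul1r. Qed.

(** Pascal's rule, read as conditioning on one Bernoulli trial; all moment computations below are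
    inductions on this recursion. *)
Lemma binmeanS n (G : nat -> R) :
  binmean n.+1 G
  = (1 - p) * binmean n G + p * binmean n (fun k => G k.+1).
Proof.
have out k : (n < k)%N -> binmass n k = 0.
  by move=> nk; rewrite /binmass bin_small // !mul0r.
have -> : binmean n G = \sum_(k < n.+2) binmass n k * G k.
  by rewrite big_ord_recr /= (out n.+1) // mul0r addr0.
rewrite /binmean big_ord_recl [in X in _ = X + _]big_ord_recl mulrDr -addrA.
congr (_ + _); first by rewrite /binmass !bin0 !subn0 !expr0 exprS; ring.
rewrite !mulr_sumr -big_split /=; apply: eq_bigr => k _.
rewrite /bump /= add1n /binmass binS subSS natrD.
case: (ltngtP k n) (ltn_ord k) => [kn _|nk|-> _].
- have -> : (n - k = (n - k.+1).+1)%N by rewrite subnSK.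
  by rewrite !exprS; ring.
- by rewrite ltnS leqNgt nk.
- rewrite (bin_small (ltnSn n)) subnn !exprS; ring.
Qed.

Lemma binmean_cst n c : binmean n (fun=> c) = c.
Proof. by elim: n => [|n IH]; rewrite ?binmean0 // binmeanS IH; ring. Qed.

Lemma binmean_nat n : binmean n (fun k => k%:R) = p * n%:R.
Proof.
elim: n => [|n IH]; first by rewrite binmean0 mulr0.
rewrite binmeanS IH (eq_binmean (G := fun k => k%:R + 1)); last first.
  by move=> k _; rewrite natr1.
by rewrite binmeanD binmean_cst IH -[n.+1%:R]natr1; ring.
Qed.

Lemma binmean_expr n r : binmean n (fun k => r ^+ k) = (1 - p + p * r) ^+ n.
Proof.
elim: n => [|n IH]; first by rewrite binmean0.
rewrite binmeanS IH (eq_binmean (G := fun k => r * r ^+ k)); last first.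
  by move=> k _; rewrite exprS.
by rewrite binmeanZ IH exprS; ring.
Qed.

Lemma binmean_expr_compl n r :
  binmean n (fun k => r ^+ (n - k)) = ((1 - p) * r + p) ^+ n.
Proof.
elim: n => [|n IH]; first by rewrite binmean0.
rewrite binmeanS (eq_binmean (G := fun k => r * r ^+ (n - k))); last first.
  by move=> k kn; rewrite subSn // exprS.
rewrite (eq_binmean (F := fun k => r ^+ (n.+1 - k.+1))
                    (G := fun k => r ^+ (n - k))); last by move=> k _; rewrite subSS.
by rewrite binmeanZ IH exprS; ring.
Qed.

Lemma binmean_sqr n m : binmean n (fun k => ((n + k)%:R - m) ^+ 2)
  = n%:R * (p * (1 - p)) + ((1 + p) * n%:R - m) ^+ 2.
Proof.
elim: n m => [|n IH] m; first by rewrite binmean0; ring.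
rewrite binmeanS.
rewrite (eq_binmean (G := fun k => ((n + k)%:R - (m - 1)) ^+ 2)); last first.
  by move=> k _; rewrite addSn -[(n + k).+1%:R]natr1; ring.
rewrite (eq_binmean (F := fun k => ((n.+1 + k.+1)%:R - m) ^+ 2)
                    (G := fun k => ((n + k)%:R - (m - 2)) ^+ 2)); last first.
  by move=> k _; rewrite addSn addnS -[(n + k).+2%:R]natr1 -[(n + k).+1%:R]natr1; ring.
by rewrite !IH -[n.+1%:R]natr1; ring.
Qed.

(** The x + K are the positions of a walk with steps 1 and 2, which visits each point at most once
    and lies below 2 N during its first N positions. In the induction, conditioning on the first
    step shifts [w] by 1 or by 2. *)
Lemma binmean_renewal N (w : nat -> R) : (forall y, 0 <= w y) ->
  \sum_(x < N) binmean x (fun k => w (x + k)%N) <= \sum_(y < N.*2) w y.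
Proof.
elim: N w => [|N IH] w w0; first by rewrite !big_ord0.
rewrite big_ord_recl binmean0 addn0 doubleS big_ord_recl lerD2l.
have -> : \sum_(i < N) binmean (lift ord0 i) (fun k => w (lift ord0 i + k)%N) =
    (1 - p) * \sum_(i < N) binmean i (fun k => w (i + k).+1)
    + p * \sum_(i < N) binmean i (fun k => w (i + k).+2).
  rewrite !mulr_sumr -big_split /=; apply: eq_bigr => i _.
  by rewrite /bump /= add1n binmeanS; congr (_ + _ * _);
     apply: eq_binmean => k _; rewrite ?addSn ?addnS.
set S := \sum_(_ < _) w _.
have h1 : \sum_(i < N) binmean i (fun k => w (i + k).+1) <= S.
  apply: (le_trans (IH (fun y => w y.+1) _)) => //.
  by rewrite /S big_ord_recr /= lerDl.
have h2 : \sum_(i < N) binmean i (fun k => w (i + k).+2) <= S.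
  apply: (le_trans (IH (fun y => w y.+2) _)) => //.
  by rewrite /S big_ord_recl /= lerDr.
have p1 : 0 <= 1 - p by rewrite subr_ge0 ltW.
rewrite (_ : S = (1 - p) * S + p * S); last by ring.
by rewrite lerD ?ler_wpM2l // ltW.
Qed.

(** The right side is minus the entropy of K; the powers of p and 1 - p contribute - n h(p) because
    K has mean p n. *)
Lemma binmean_ln_bin n :
  binmean n (fun k => ln ('C(n, k)%:R)) - n%:R * binary_entropy p
  = binmean n (fun k => ln (binmass n k)).
Proof.
have p1 : 0 < 1 - p by rewrite subr_gt0.
rewrite (eq_binmean (F := fun k => ln (binmass n k))
  (G := fun k => ln ('C(n, k)%:R) + ((ln p - ln (1 - p)) * k%:R
                                     + n%:R * ln (1 - p)))); last first.
  move=> k kn; have C0 : (0 : R) < 'C(n, k)%:R by rewrite ltr0n bin_gt0.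
  rewrite /binmass !lnM ?posrE ?mulr_gt0 ?exprn_gt0 //.
  rewrite !lnXn // -[ln p *+ k]mulr_natr -[_ *+ (n - k)]mulr_natr natrB //; ring.
by rewrite !binmeanD binmeanZ binmean_nat binmean_cst /binary_entropy; ring.
Qed.

Lemma binmass_le1 n k : (k <= n)%N -> binmass n k <= 1.
Proof.
move=> kn; rewrite -(binmean_cst n 1) /binmean.
have kn' : (k < n.+1)%N by [].
rewrite (bigD1 (Ordinal kn')) //= mulr1 lerDl sumr_ge0 // => i _.
by rewrite mulr1 ltW // binmass_gt0 // -ltnS.
Qed.

Lemma binmean_ln_mass_le0 n : binmean n (fun k => ln (binmass n k)) <= 0.
Proof.
rewrite -(binmean_cst n 0); apply: le_binmean => k kn.
by rewrite ln_le0 // binmass_le1.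
Qed.

(* Gibbs' inequality against the uniform distribution. *)
Lemma binmean_ln_mass_ge n :
  - ln n.+1%:R <= binmean n (fun k => ln (binmass n k)).
Proof.
have n0 : (0 : R) < n.+1%:R by rewrite ltr0n.
rewrite -(binmean_cst n (- ln n.+1%:R)) -subr_ge0 -binmeanB.
apply: (@le_trans _ _ (binmean n (fun k => 1 - (n.+1%:R * binmass n k)^-1))).
  rewrite binmeanB binmean_cst /binmean.
  rewrite (eq_bigr (fun=> n.+1%:R^-1)); last first.
    move=> k _; have := @binmass_gt0 n k; rewrite -ltnS => /(_ (ltn_ord k)) m0.
    by rewrite invfM mulrCA divff ?mulr1 // gt_eqF.
  by rewrite sumr_const card_ord -[_^-1 *+ _]mulr_natr mulVf ?subrr // gt_eqF.
apply: le_binmean => k kn; have m0 := binmass_gt0 kn.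
have nm : 0 < n.+1%:R * binmass n k by apply: mulr_gt0.
have nm0 : 0 < (n.+1%:R * binmass n k)^-1 by rewrite invr_gt0.
rewrite -subr_ge0 (_ : _ - (1 - _) = (n.+1%:R * binmass n k)^-1 - 1
  + (ln n.+1%:R + ln (binmass n k))); last by ring.
rewrite -lerBlDr sub0r.
rewrite -[ln _ + _]lnM ?posrE // -lnV ?posrE //.
move: nm0; set u := (_ * _)^-1 => u0.
have := @le_ln1Dx _ (u - 1); rewrite [1 + _]addrC subrK => h.
by apply: h; rewrite ltrBrDl subrr.
Qed.

End BinomialMean.

(** * The kernel 1 / (t ln (1 - t)) *)

Section UnitIntegral.
Context {R : realType}.
Implicit Types (c t : R) (f g : R -> R).

Local Notation mu := (@lebesgue_measure R).
Local Notation I01 := `[0 : R, 1]%classic.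

Lemma bounded_integrable01 f M : measurable_fun I01 f ->
  (forall t, 0 <= t <= 1 -> `|f t| <= M) -> mu.-integrable I01 (EFin \o f).
Proof.
move=> mf fM; apply: measurable_bounded_integrable => //.
  by have := lebesgue_measure_itv `[0 : R, 1]%R; rewrite /= lte_fin ltr01 => ->; rewrite oppr0 adde0 ltry.
exists M; split; first by rewrite num_real.
move=> N MN t /=; rewrite in_itv /= => t01.
by apply: (le_trans (fM t t01)); exact: ltW.
Qed.

Lemma is_derive_continuous (f : R -> R) (t d : R) :
  is_derive t 1 f d -> {for t, continuous f}.
Proof.
by move=> [dt _]; apply: differentiable_continuous; exact/derivable1_diffP.
Qed.

Lemma onem_powR_cvg (c t : R) : 0 < c -> 0 <= t <= 1 ->
  ((1 - x) `^ c @[x --> t^'-] --> (1 - t) `^ c).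
Proof.
move=> c0 /andP[t0]; rewrite le_eqVlt => /predU1P[->|t1].
  rewrite subrr powR0 ?gt_eqF //.
  apply: (@cvg_comp _ _ _ (fun x => 1 - x) (fun y => y `^ c) _ (0^'+)); last first.
    exact: powR_cvg0.
  move=> A /=; rewrite /at_right /at_left => -[e /= e0 H].
  exists e => //= x /=; rewrite /ball /= => xe x1.
  by apply: H => /=; rewrite ?subr_gt0 // sub0r normrN.
apply: cvg_at_left_filter.
apply: (@cvg_comp _ _ _ (fun x => 1 - x) (fun y => y `^ c) _ (nbhs (1 - t))).
  by apply: cvgB; [exact: cvg_cst|exact: cvg_id].
have t1' : 0 < 1 - t by rewrite subr_gt0.
exact: is_derive_continuous (is_derive1_powR c t1').
Qed.

Lemma is_derive_onem_powR (c t : R) : t < 1 ->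
  is_derive t 1 (fun x => (1 - x) `^ c) (- (c * (1 - t) `^ (c - 1))).
Proof.
move=> t1; have t1' : 0 < 1 - t by rewrite subr_gt0.
have d1 := @is_derive1_powR R c (1 - t) t1'.
have d2 : is_derive t 1 (fun x : R => 1 - x) (-1).
  by apply: is_derive_eq; rewrite add0r mul1r.
have := @is_derive1_comp R (@powR R ^~ c) (fun x : R => 1 - x) t _ _ d1 d2.
by rewrite mulrN1.
Qed.

Lemma Rintegral_onem_powR c : 0 < c ->
  \int[mu]_(t in I01) ((1 - t) `^ c) = (c + 1)^-1.
Proof.
move=> c0; have c1 : 0 < c + 1 by rewrite addr_gt0.
pose F (t : R) := (1 - t) `^ (c + 1) * (- (c + 1)^-1).
have dF t : t < 1 -> is_derive t 1 F ((1 - t) `^ c).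
  move=> t1; have := is_derive_onem_powR (c + 1) t1.
  rewrite addrK => d; apply: is_derive_eq.
  by rewrite scaler0 add0r scalerN -mulNr /GRing.scale /=; field; rewrite gt_eqF.
have contpow (e : R) : 0 < e -> {in `]0, 1[, forall t, {for t, continuous (fun x : R => (1 - x) `^ e)}}.
  move=> e0 t; rewrite in_itv /= => /andP[_ t1].
  exact: is_derive_continuous (is_derive_onem_powR e t1).
have cont0 (e : R) : 0 < e -> {for 0, continuous (fun x : R => (1 - x) `^ e)}.
  move=> e0; exact: is_derive_continuous (is_derive_onem_powR e ltr01).
rewrite /Rintegral (@continuous_FTC2 R (fun t => (1 - t) `^ c) F) //=.
- rewrite /F subrr subr0 powR0 ?gt_eqF // powR1.
  by rewrite mul0r mul1r sub0r opprK.
- apply/continuous_within_itvP => //; split.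
  + exact: contpow.
  + exact/cvg_at_right_filter/cont0.
  + by apply: onem_powR_cvg; rewrite ?ler01 ?lexx.
- split.
  + by move=> t; rewrite in_itv /= => /andP[_ t1]; have [] := dF t t1.
  + apply: cvgM; last exact: cvg_cst.
    exact/cvg_at_right_filter/cont0.
  + apply: cvgM; last exact: cvg_cst.
    by apply: onem_powR_cvg; rewrite ?ler01 ?lexx.
- move=> t; rewrite in_itv /= => /andP[_ t1].
  by rewrite derive1E; have [_ ->] := dF t t1.
Qed.

Lemma measurable_onem_powR c : measurable_fun I01 (fun t : R => (1 - t) `^ c).
Proof.
apply: (measurable_funS measurableT (@subsetT _ _)).
apply: (@measurableT_comp _ _ _ _ _ _ (fun x : R => x `^ c)) => //.
exact: measurable_funB.
Qed.

Lemma integrable_onem_powR c : 0 <= c ->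
  mu.-integrable I01 (EFin \o (fun t : R => (1 - t) `^ c)).
Proof.
move=> c0; apply: (@bounded_integrable01 _ 1); first exact: measurable_onem_powR.
move=> t /andP[t0 t1]; rewrite ger0_norm ?powR_ge0 //.
apply: (@le_trans _ _ (1 `^ c)); last by rewrite powR1.
apply: ge0_ler_powR; rewrite ?nnegrE ?subr_ge0 //; lra.
Qed.

(* Equal to 0 at t = 0 and at t = 1, where Rocq divides by 0. *)
Definition lnker (t : R) : R := (t * ln (1 - t))^-1.

Lemma lnker_le0 t : 0 <= t <= 1 -> lnker t <= 0.
Proof.
move=> /andP[t0 t1]; rewrite /lnker invr_le0 mulr_ge0_le0 //.
by rewrite ln_le0 // lerBlDr lerDl.
Qed.

Lemma onem_ln_le t : 0 <= t < 1 -> t <= - ln (1 - t).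
Proof.
move=> /andP[t0 t1]; rewrite lerNr.
by rewrite (le_trans (le_ln1Dx _)) // ltrN2.
Qed.

(** Follows from t <= - ln (1 - t). A numerator that vanishes quadratically at 0 is therefore enough
    for integrability against [lnker]. *)
Lemma lnker_ge t : 0 < t <= 1 -> - lnker t <= (t ^+ 2)^-1.
Proof.
move=> /andP[t0]; rewrite le_eqVlt => /predU1P[->|t1].
  by rewrite /lnker subrr ln0 // mulr0 invr0 oppr0 expr1n invr1.
have h : t <= - ln (1 - t) by apply: onem_ln_le; rewrite ltW.
rewrite /lnker -invrN -mulrN lef_pV2 ?posrE ?mulr_gt0 ?exprn_gt0 //; last lra.
by rewrite expr2 ler_wpM2l // ltW.
Qed.

Lemma measurable_lnker : measurable_fun I01 lnker.
Proof.
(* Inversion becomes the power -1 of a nonnegative number; [powR] sends 0 to 0 there, as inversion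
   does. *)
apply: (eq_measurable_fun (fun t : R => - (t * - ln (1 - t)) `^ (-1))).
  move=> t; rewrite inE /= in_itv /= => /andP[t0 t1].
  rewrite powR_inv1 ?mulrN ?invrN ?opprK // oppr_ge0 mulr_ge0_le0 //.
  by rewrite ln_le0 // lerBlDr lerDl.
apply: (measurable_funS measurableT (@subsetT _ _)).
apply: measurableT_comp => //.
apply: (@measurableT_comp _ _ _ _ _ _ (fun x : R => x `^ (-1))) => //.
apply: measurable_funM => //; apply: measurableT_comp => //.
by apply: measurableT_comp; [exact: measurable_ln|exact: measurable_funB].
Qed.

End UnitIntegral.

(** * The root of the duplication polynomial *)

Section PowerTaylor.
Context {R : realType}.
Variable g : R.
Hypotheses (g_ge0 : 0 <= g) (g_le1 : g <= 1).

Lemma expr_ge_tangent1 k :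
  0 <= g ^+ k - 1 + k%:R * (1 - g) <= k%:R ^+ 2 * (1 - g) ^+ 2.
Proof.
elim: k => [|k /andP[l u]]; first by rewrite !mul0r expr0 subrr expr0n /= mul0r addr0 lexx.
have gk0 : 0 <= g ^+ k by rewrite exprn_ge0.
have gk1 : g ^+ k <= 1 by rewrite exprn_ile1.
have k0 : (0 : R) <= k%:R by [].
have -> : g ^+ k.+1 - 1 + k.+1%:R * (1 - g)
    = (g ^+ k - 1 + k%:R * (1 - g)) + (1 - g) * (1 - g ^+ k).
  by rewrite exprS -natr1; ring.
have d0 : 0 <= (1 - g) * (1 - g ^+ k) by rewrite mulr_ge0 // subr_ge0.
have d1 : (1 - g) * (1 - g ^+ k) <= (1 - g) * (k%:R * (1 - g)).
  apply: ler_wpM2l; first by rewrite subr_ge0.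
  by rewrite -subr_ge0 opprB addrC.
have d2 : 0 <= k%:R * (1 - g) ^+ 2 by rewrite mulr_ge0 ?sqr_ge0.
have d3 : 0 <= (1 - g) ^+ 2 by rewrite sqr_ge0.
have -> : k.+1%:R ^+ 2 * (1 - g) ^+ 2 = k%:R ^+ 2 * (1 - g) ^+ 2
    + (1 - g) * (k%:R * (1 - g)) + k%:R * (1 - g) ^+ 2 + (1 - g) ^+ 2.
  by rewrite -natr1; ring.
by apply/andP; split; lra.
Qed.

Lemma expr_le_tangent k :
  0 <= 1 - g ^+ k - k%:R * (1 - g) * g ^+ k <= k%:R ^+ 2 * (1 - g) ^+ 2.
Proof.
elim: k => [|k /andP[l u]]; first by rewrite !mul0r expr0 subrr expr0n /= mul0r subr0 lexx.
have gk0 : 0 <= g ^+ k by rewrite exprn_ge0.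
have gk1 : g ^+ k <= 1 by rewrite exprn_ile1.
have k0 : (0 : R) <= k%:R by [].
have step : 1 - g ^+ k.+1 - k.+1%:R * (1 - g) * g ^+ k.+1
    = (1 - g ^+ k - k%:R * (1 - g) * g ^+ k) + (1 - g) ^+ 2 * k.+1%:R * g ^+ k.
  by rewrite exprS -natr1; ring.
have d0 : 0 <= (1 - g) ^+ 2 * k.+1%:R by rewrite mulr_ge0 ?sqr_ge0.
rewrite step; apply/andP; split; first by rewrite addr_ge0 // mulr_ge0.
apply: (@le_trans _ _ (k%:R ^+ 2 * (1 - g) ^+ 2 + (1 - g) ^+ 2 * k.+1%:R)).
  by apply: lerD => //; rewrite ler_piMr.
rewrite -natr1; have : 0 <= k%:R * (1 - g) ^+ 2 by rewrite mulr_ge0 ?sqr_ge0.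
by nra.
Qed.

(** Convexity of n -> g ^ n on the integers: the linear term uses the forward difference g ^ (m + 1)
    - g ^ m = - (1 - g) g ^ m, which is a subgradient at m on both sides. *)
Lemma expr_tangent m n :
  0 <= g ^+ n - g ^+ m + (n%:R - m%:R) * (1 - g) * g ^+ m
    <= (n%:R - m%:R) ^+ 2 * (1 - g) ^+ 2.
Proof.
case: (leqP m n) => [/subnKC <-|/ltnW/subnKC <-].
  set k := (n - m)%N; have /andP[l u] := expr_ge_tangent1 k.
  have gm0 : 0 <= g ^+ m by rewrite exprn_ge0.
  have gm1 : g ^+ m <= 1 by rewrite exprn_ile1.
  rewrite natrD exprD (_ : _ + _ = g ^+ m * (g ^+ k - 1 + k%:R * (1 - g))); last by ring.
  rewrite mulr_ge0 //= (_ : m%:R + k%:R - m%:R = k%:R); last by ring.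
  by rewrite (le_trans _ u) // ler_piMl.
set k := (m - n)%N; have /andP[l u] := expr_le_tangent k.
have gm0 : 0 <= g ^+ n by rewrite exprn_ge0.
have gm1 : g ^+ n <= 1 by rewrite exprn_ile1.
rewrite natrD exprD (_ : _ + _ = g ^+ n * (1 - g ^+ k - k%:R * (1 - g) * g ^+ k)); last by ring.
rewrite mulr_ge0 //= (_ : n%:R - (n%:R + k%:R) = - k%:R); last by ring.
by rewrite sqrrN (le_trans _ u) // ler_piMl.
Qed.

End PowerTaylor.

Section DuplicationRoot.
Context {R : realType}.
Variable p : R.
Hypotheses (p_gt0 : 0 < p) (p_lt1 : p < 1).

(* The root in [0, 1] of p r ^ 2 + (1 - p) r = 1 - s: thus E[r ^ (x + K)] =
   (1 - s) ^ x when K is binomial with parameters x and p. *)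
Definition droot (s : R) : R :=
  (Num.sqrt ((1 + p) ^+ 2 - 4 * p * s) - (1 - p)) / (2 * p).

(** All parts rest on the factorisation s = (1 - r) (1 + p r). The last one says that 1 - r differs
    from s / (1 + p) only to second order, which is why the numerators of the f_i vanish
    quadratically at 0. *)
Lemma drootP s : 0 <= s <= 1 ->
  [/\ 0 <= droot s, droot s <= 1, (1 - p + p * droot s) * droot s = 1 - s,
      1 - droot s <= s & 1 - droot s - s / (1 + p) = (1 - droot s) ^+ 2 * (p / (1 + p)) ].
Proof.
move=> /andP[s0 s1].
have ps : 0 <= 4 * p * s by rewrite !mulr_ge0 // ltW.
have ps' : 0 <= 4 * p * (1 - s) by rewrite !mulr_ge0 ?subr_ge0 // ltW.
have D1 : (1 - p) ^+ 2 <= (1 + p) ^+ 2 - 4 * p * s.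
  rewrite -subr_ge0 (_ : _ - _ = 4 * p * (1 - s)) //; ring.
have D2 : (1 + p) ^+ 2 - 4 * p * s <= (1 + p) ^+ 2 by rewrite gerBl.
have S1 : 1 - p <= Num.sqrt ((1 + p) ^+ 2 - 4 * p * s).
  have {1}-> : 1 - p = Num.sqrt ((1 - p) ^+ 2) by rewrite sqrtr_sqr ger0_norm //; move: p_lt1 p_gt0 => *; lra.
  by rewrite ler_wsqrtr.
have S2 : Num.sqrt ((1 + p) ^+ 2 - 4 * p * s) <= 1 + p.
  have {2}-> : 1 + p = Num.sqrt ((1 + p) ^+ 2) by rewrite sqrtr_sqr ger0_norm //; move: p_lt1 p_gt0 => *; lra.
  by rewrite ler_wsqrtr.
have SS : Num.sqrt ((1 + p) ^+ 2 - 4 * p * s) ^+ 2 = (1 + p) ^+ 2 - 4 * p * s.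
  by rewrite sqr_sqrtr // (le_trans _ D1) // sqr_ge0.
move: S1 S2 SS; rewrite /droot; set S := Num.sqrt _ => S1 S2 SS.
have p2 : 0 < 2 * p by rewrite mulr_gt0.
have rE : (S - (1 - p)) / (2 * p) * (2 * p) = S - (1 - p).
  by rewrite divfK // gt_eqF.
move: rE; set r := (_ / _) => rE.
have SE : S = 2 * p * r + (1 - p) by rewrite mulrC rE; ring.
have r0 : 0 <= r by rewrite divr_ge0 ?subr_ge0 // ltW.
have r1 : r <= 1 by rewrite ler_pdivrMr // mul1r; lra.
have q : (1 - p + p * r) * r = 1 - s.
  move: SS; rewrite SE => SS.
  apply: (@mulfI _ (4 * p)); first by rewrite gt_eqF // mulr_gt0.
  apply/eqP; rewrite -subr_eq0.
  rewrite (_ : _ - _ = (2 * p * r + (1 - p)) ^+ 2 - ((1 + p) ^+ 2 - 4 * p * s)).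
    by rewrite SS subrr.
  by ring.
have sE : s = (1 - r) * (1 + p * r) by rewrite -[s]opprK -[- s](addKr 1) -q; ring.
have p1 : 1 + p != 0 by rewrite gt_eqF // addr_gt0.
split => //; last by rewrite sE; field.
by rewrite sE ler_peMr ?subr_ge0 // lerDl mulr_ge0 // ltW.
Qed.

Lemma droot_num_le y s : 0 <= s <= 1 ->
  `|1 - s * y%:R / (1 + p) - droot s ^+ y| <= y%:R ^+ 2 * s ^+ 2.
Proof.
move=> s01; have [r0 r1 _ r2 r3] := drootP s01.
have /andP[l u] := expr_ge_tangent1 r0 r1 y.
have p1 : 0 < 1 + p by rewrite addr_gt0.
have pp : 0 <= p / (1 + p) <= 1.
  by rewrite divr_ge0 ?(ltW p1) ?(ltW p_gt0) //= ler_pdivrMr // mul1r lerDr.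
have sr : (1 - droot s) ^+ 2 <= s ^+ 2 by rewrite ler_sqr // nnegrE; lra.
have y2 : (y%:R : R) <= y%:R ^+ 2.
  by rewrite -natrX ler_nat -mulnn; case: y {l u} => // y; rewrite leq_pmulr.
rewrite (_ : 1 - s * y%:R / (1 + p) - droot s ^+ y =
  y%:R * (1 - droot s - s / (1 + p)) - (droot s ^+ y - 1 + y%:R * (1 - droot s))); last by ring.
rewrite r3.
set e := (_ - 1 + _) in l u *; set d := (1 - _) ^+ 2 in u sr *.
have d0 : 0 <= d by rewrite sqr_ge0.
have y0 : (0 : R) <= y%:R by [].
have /andP[pp0 pp1] := pp.
have dp0 : 0 <= d * (p / (1 + p)) by apply: mulr_ge0.
have A1 : 0 <= y%:R * (d * (p / (1 + p))) by apply: mulr_ge0.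
have A2 : y%:R * (d * (p / (1 + p))) <= y%:R ^+ 2 * s ^+ 2.
  by apply: ler_pM => //; rewrite (le_trans _ sr) // ler_piMr.
have A3 : y%:R ^+ 2 * d <= y%:R ^+ 2 * s ^+ 2 by rewrite ler_wpM2l ?sqr_ge0.
by rewrite ler_norml; apply/andP; split; lra.
Qed.

End DuplicationRoot.

(** * The logarithm of the factorial as an integral *)

Section Integral01.
Context {R : realType}.
Implicit Types (f g : R -> R) (c : R).

Definition integrable01 f :=
  lebesgue_measure.-integrable `[0 : R, 1]%classic (EFin \o f).

Definition int01 f : R := Rintegral lebesgue_measure `[0 : R, 1]%classic f.

Lemma integrable01D f g : integrable01 f -> integrable01 g ->
  integrable01 (fun t => f t + g t).
Proof. by move=> hf hg; have h := integrableD _ hf hg; exact: h. Qed.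

Lemma int01D f g : integrable01 f -> integrable01 g ->
  int01 (fun t => f t + g t) = int01 f + int01 g.
Proof. by move=> hf hg; exact: RintegralD. Qed.

Lemma integrable01Z c f : integrable01 f -> integrable01 (fun t => c * f t).
Proof. by move=> hf; have h := integrableZl _ c hf; exact: h. Qed.

Lemma int01Z c f : integrable01 f -> int01 (fun t => c * f t) = c * int01 f.
Proof. by move=> hf; exact: RintegralZl. Qed.

Lemma integrable01B f g : integrable01 f -> integrable01 g ->
  integrable01 (fun t => f t - g t).
Proof. by move=> hf hg; have h := integrableB _ hf hg; exact: h. Qed.

Lemma integrable01_cst c : integrable01 (fun=> c).
Proof. by apply: (@bounded_integrable01 _ _ `|c|). Qed.

Lemma int01_cst c : int01 (fun=> c) = c.
Proof.
rewrite /int01 Rintegral_cst //.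
have := lebesgue_measure_itv `[0 : R, 1]%R; rewrite /= lte_fin ltr01 => ->.
by rewrite oppr0 adde0 /= mulr1.
Qed.

Lemma int01_sum n (F : nat -> R -> R) : (forall k, (k < n)%N -> integrable01 (F k)) ->
  integrable01 (fun t => \sum_(k < n) F k t) /\
  int01 (fun t => \sum_(k < n) F k t) = \sum_(k < n) int01 (F k).
Proof.
elim: n => [|n IH] hF.
  under eq_fun do rewrite big_ord0.
  by rewrite big_ord0 int01_cst; split => //; exact: integrable01_cst.
have [h1 h2] : integrable01 (fun t => \sum_(k < n) F k t) /\
    int01 (fun t => \sum_(k < n) F k t) = \sum_(k < n) int01 (F k).
  by apply: IH => k kn; apply: hF; rewrite ltnS ltnW.
under eq_fun do rewrite big_ord_recr /=.
rewrite big_ord_recr /= -h2; split; first by apply: integrable01D => //; exact: hF.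
by rewrite int01D //; exact: hF.
Qed.

Lemma eq_int01 f g : (forall t, 0 <= t <= 1 -> f t = g t) -> int01 f = int01 g.
Proof.
move=> fg; apply: eq_Rintegral => t; rewrite inE /= in_itv /= => t01.
exact: fg.
Qed.

(* The endpoint 0, where the kernels below are discontinuous, is left out. *)
Lemma le_int01 f g : integrable01 f -> integrable01 g ->
  (forall t, 0 < t <= 1 -> f t <= g t) -> int01 f <= int01 g.
Proof.
move=> hf hg fg; rewrite /int01.
have sub h : integrable01 h ->
    lebesgue_measure.-integrable `]0 : R, 1]%classic (EFin \o h).
  by apply: integrableS => //; exact: subset_itv_oc_cc.
rewrite -!Rintegral_itv_obnd_cbnd; [|exact: sub hg|exact: sub hf].
apply: le_Rintegral; [by []|exact: sub hf|exact: sub hg|].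
by move=> t; rewrite /= in_itv /= => t01; exact: fg.
Qed.

End Integral01.

Section LogFactorial.
Context {R : realType}.

Definition lnfact_fun n (t : R) := (1 - t * n%:R - (1 - t) ^+ n) * lnker t.

Lemma integrable_lnker_num (u : R -> R) M :
  measurable_fun `[0 : R, 1]%classic u ->
  (forall t, 0 < t <= 1 -> `|u t| <= M * t ^+ 2) ->
  integrable01 (fun t => u t * lnker t).
Proof.
move=> mu uM; apply: (@bounded_integrable01 _ _ M).
  by apply: measurable_funM => //; exact: measurable_lnker.
have M0 : 0 <= M by have := uM 1; rewrite expr1n mulr1 ltr01 lexx => /(_ isT); apply: le_trans.
move=> t /andP[]; rewrite le_eqVlt => /predU1P[<-|t0] t1.
  by rewrite /lnker mul0r invr0 mulr0 normr0.
have t01 : 0 < t <= 1 by rewrite t0.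
rewrite normrM (ler0_norm (lnker_le0 _)); last by rewrite ltW.
apply: (@le_trans _ _ (M * t ^+ 2 * (t ^+ 2)^-1)).
  by apply: ler_pM => //; [rewrite oppr_ge0 lnker_le0 // ltW|exact: uM|exact: lnker_ge].
by rewrite mulfK // expf_neq0 // gt_eqF.
Qed.

Lemma integrable_lnfact n : integrable01 (lnfact_fun n).
Proof.
apply: (@integrable_lnker_num _ (n%:R ^+ 2)).
  apply: measurable_funB.
    by apply: measurable_funB => //; apply: measurable_funM.
  by apply: measurable_funX; exact: measurable_funB.
move=> t /andP[t0 t1].
have /andP[l u] := @expr_ge_tangent1 _ (1 - t) ltac:(by rewrite subr_ge0) ltac:(by rewrite gerBl ltW) n.
rewrite subKr in l u.
by rewrite distrC (_ : _ - _ = (1 - t) ^+ n - 1 + n%:R * t) ?ger0_norm //; ring.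
Qed.

(** Each increment ln ((k + 1) / k) lies between 1 / (k + 1) and 1 / k. Used both to evaluate a
    Frullani integral and for the divergence of the harmonic series. *)
Lemma ln_harmonic_bounds (N m : nat) : (0 < N)%N ->
  \sum_(j < m) ((N + j.+1)%:R : R)^-1 <= ln ((N + m)%:R / N%:R)
    <= \sum_(j < m) ((N + j)%:R : R)^-1.
Proof.
move=> N0; have N0' : (0 : R) < N%:R by rewrite ltr0n.
elim: m => [|m /andP[l u]].
  by rewrite !big_ord0 addn0 divff ?gt_eqF // ln1 lexx.
have a0 : (0 : R) < (N + m)%:R by rewrite ltr0n addn_gt0 N0.
have b0 : (0 : R) < (N + m.+1)%:R by rewrite ltr0n addnS.
have -> : (N + m.+1)%:R / N%:R = ((N + m)%:R / N%:R) * ((N + m.+1)%:R / (N + m)%:R) :> R.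
  by rewrite [RHS]mulrC mulrA divfK // gt_eqF.
rewrite lnM ?posrE ?divr_gt0 // !big_ord_recr /=.
have ba : (N + m.+1)%:R = (N + m)%:R + 1 :> R by rewrite addnS natr1.
apply/andP; split; apply: lerD => //.
- have := @le_ln1Dx R (- (N + m.+1)%:R^-1).
  have -> : 1 - (N + m.+1)%:R^-1 = ((N + m.+1)%:R / (N + m)%:R)^-1 :> R.
    by apply: (mulIf (lt0r_neq0 b0)); rewrite invf_div mulrBl mul1r mulVf ?divfK ?gt_eqF // ba addrK.
  rewrite lnV ?posrE ?divr_gt0 // lerN2; apply.
  by rewrite ltrN2 invf_lt1 // ltr1n addnS ltnS addn_gt0 N0.
- have := @le_ln1Dx R (N + m)%:R^-1.
  have -> : 1 + (N + m)%:R^-1 = (N + m.+1)%:R / (N + m)%:R :> R.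
    by rewrite ba mulrDl divff ?mul1r // gt_eqF.
  by apply; apply: (@lt_trans _ _ 0); rewrite ?oppr_lt0 ?ltr01 ?invr_gt0.
Qed.


(** The increment of [lnfact_fun] from n to n + 1; its integral is the Frullani integral of (s ^ n -
    1) / ln s, to be shown equal to ln (n + 1). *)
Let J n (t : R) := t * ((1 - t) ^+ n - 1) * lnker t.

Let integrable_J n : integrable01 (J n).
Proof.
have := integrable01B (integrable_lnfact n.+1) (integrable_lnfact n).
apply: eq_integrable => // t _ /=; congr EFin.
by rewrite /lnfact_fun /J exprS -natr1; ring.
Qed.

(* Riemann sums of the exponents: with s = (1 - t) ^ (1 / N), the integrand is
   (1 / N) ((s - 1) / ln s) (1 + s + ... + s ^ (n N - 1)), and s <= (s - 1) / ln s <= 1. *)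
Let J_bounds n N t : (0 < N)%N -> 0 < t <= 1 ->
  N%:R^-1 * \sum_(j < n * N) ((1 - t) `^ (j.+1%:R / N%:R)) <= J n t
    <= N%:R^-1 * \sum_(j < n * N) ((1 - t) `^ (j%:R / N%:R)).
Proof.
move=> N0 /andP[t0]; have N0' : (0 : R) < N%:R by rewrite ltr0n.
rewrite le_eqVlt => /predU1P[->|t1].
  rewrite /J /lnker subrr ln0 // mulr0 invr0 mulr0; apply/andP; split.
    rewrite big1 ?mulr0 // => j _; rewrite powR0 //.
    by rewrite gt_eqF // divr_gt0 // ltr0n.
  by rewrite mulr_ge0 ?invr_ge0 // sumr_ge0 // => j _; rewrite powR_ge0.
have u0 : 0 < 1 - t by rewrite subr_gt0.
set s := (1 - t) `^ N%:R^-1.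
have s0 : 0 < s by rewrite powR_gt0.
have sE j : (1 - t) `^ (j%:R / N%:R) = s ^+ j.
  by rewrite -powR_mulrn ?ltW // -powRrM mulrC.
have sN : s ^+ N = 1 - t by rewrite -sE divff ?gt_eqF // powRr1 // ltW.
have lnE : ln (1 - t) = N%:R * ln s by rewrite -sN lnXn // mulr_natl.
have ln0' : ln (1 - t) < 0 by rewrite ln_lt0 // u0 gtrBl.
have lns : ln s < 0 by rewrite -(pmulr_rlt0 _ N0') -lnE.
have s1 : s < 1.
  by rewrite ltNge; apply/negP => s1; have := ln_ge0 s1; rewrite leNgt lns.
have JE : J n t = N%:R^-1 * ((s - 1) / ln s) * \sum_(j < n * N) s ^+ j.
  rewrite /J /lnker lnE -sN -exprM [(N * n)%N]mulnC subrX1 !invfM.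
  have -> : t * ((s - 1) * (\sum_(i < n * N) s ^+ i)) * (t^-1 * (N%:R^-1 / ln s))
     = (t * t^-1) * (N%:R^-1 * ((s - 1) / ln s) * \sum_(i < n * N) s ^+ i) by ring.
  by rewrite divff ?gt_eqF // mul1r.
have S0 : 0 <= \sum_(j < n * N) s ^+ j by rewrite sumr_ge0 // => j _; rewrite exprn_ge0 // ltW.
have ratio_le : (s - 1) / ln s <= 1.
  rewrite ler_ndivrMr // mul1r; have := @le_ln1Dx R (s - 1).
  by rewrite [1 + _]addrC subrK; apply; rewrite ltrBrDl subrr.
have ratio_ge : s <= (s - 1) / ln s.
  rewrite ler_ndivlMr //; have := @le_ln1Dx R (s^-1 - 1).
  rewrite [1 + _]addrC subrK lnV ?posrE // ltrBrDl subrr invr_gt0 => /(_ s0) h.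
  have := ler_wpM2l (ltW s0) h; rewrite mulrBr mulfV ?gt_eqF // mulr1 mulrN.
  by rewrite lerNl opprB.
have -> : \sum_(j < n * N) ((1 - t) `^ (j.+1%:R / N%:R)) = s * \sum_(j < n * N) s ^+ j.
  by rewrite mulr_sumr; apply: eq_bigr => j _; rewrite sE exprS.
have -> : \sum_(j < n * N) ((1 - t) `^ (j%:R / N%:R)) = \sum_(j < n * N) s ^+ j.
  by apply: eq_bigr => j _; rewrite sE.
rewrite JE -!mulrA !ler_pM2l ?invr_gt0 //.
by rewrite mulrA ler_wpM2r //= ler_piMl.
Qed.

(** The integral and ln (n + 1) lie between the same two harmonic sums, which differ by at most 1 /
    N; N is arbitrary. *)
Let int_J n : int01 (J n) = ln n.+1%:R.
Proof.
have intpow c : 0 <= c -> int01 (fun t : R => (1 - t) `^ c) = (c + 1)^-1.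
  rewrite le_eqVlt => /predU1P[<-|c0]; last exact: Rintegral_onem_powR.
  under eq_fun do rewrite powRr0.
  by rewrite int01_cst add0r invr1.
have sq N : (0 < N)%N -> `|int01 (J n) - ln n.+1%:R| <= N%:R^-1.
  move=> N0; have N0' : (0 : R) < N%:R by rewrite ltr0n.
  have /andP[hl hu] := ln_harmonic_bounds (n * N) N0.
  have e : (N + n * N)%:R / N%:R = n.+1%:R :> R.
    by rewrite -mulSn natrM mulfK // gt_eqF.
  rewrite e in hl hu.
  have ipow (i : nat -> nat) k : (k < n * N)%N -> integrable01 (fun t : R => (1 - t) `^ ((i k)%:R / N%:R)).
    by move=> _; apply: integrable_onem_powR; rewrite divr_ge0.
  have epow (i : nat -> nat) : N%:R^-1 * \sum_(j < n * N) int01 (fun t : R => (1 - t) `^ ((i j)%:R / N%:R))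
      = \sum_(j < n * N) (N + i j)%:R^-1.
    rewrite mulr_sumr; apply: eq_bigr => j _; rewrite intpow ?divr_ge0 //.
    rewrite -invfM mulrDr mulrCA divff ?gt_eqF // !mulr1 addrC natrD //.
  have [i1 e1] := int01_sum (ipow (fun j => j.+1)).
  have [i2 e2] := int01_sum (ipow id).
  have L : \sum_(j < n * N) ((N + j.+1)%:R : R)^-1 <= int01 (J n).
    rewrite -(epow (fun j => j.+1)) -e1 -int01Z //.
    by apply: le_int01 => [||t t01]; [exact: integrable01Z| |case/andP: (J_bounds n N0 t01)].
  have U : int01 (J n) <= \sum_(j < n * N) ((N + j)%:R : R)^-1.
    rewrite -(epow id) -e2 -int01Z //.
    by apply: le_int01 => [||t t01]; [|exact: integrable01Z|case/andP: (J_bounds n N0 t01)].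
  have D : \sum_(j < n * N) ((N + j)%:R : R)^-1
      <= \sum_(j < n * N) ((N + j.+1)%:R : R)^-1 + N%:R^-1.
    have : \sum_(j < (n * N).+1) ((N + j)%:R : R)^-1 = N%:R^-1 + \sum_(j < n * N) ((N + j.+1)%:R : R)^-1.
      by rewrite big_ord_recl /= addn0.
    rewrite big_ord_recr /= addrC => h.
    rewrite [X in _ <= X]addrC -h lerDr invr_ge0 //.
  by rewrite ler_distl; apply/andP; split; lra.
apply/eqP; rewrite -subr_eq0 -normr_le0; apply/ler_addgt0Pr => e e0.
rewrite add0r; have := sq (Num.truncn e^-1).+1 isT => /le_trans; apply.
by rewrite invf_ple ?posrE // ltW // truncnS_gt.
Qed.

Lemma int01_lnfact n : int01 (lnfact_fun n) = ln (n`!)%:R.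
Proof.
elim: n => [|n IH].
  rewrite fact0 ln1 -(int01_cst (0 : R)); apply: eq_int01 => t _.
  by rewrite /lnfact_fun mulr0 expr0 subr0 subrr mul0r.
rewrite factS natrM lnM ?posrE ?ltr0n ?fact_gt0 // -IH -int_J -int01D //; last exact: integrable_lnfact.
by apply: eq_int01 => t _; rewrite /lnfact_fun /J exprS -natr1; ring.
Qed.

End LogFactorial.

(** * The weights of the output law *)

Section LogWeight.
Context {R : realType}.
Variable p : R.
Hypotheses (p_gt0 : 0 < p) (p_lt1 : p < 1).

(** Common form of [f1], [f2], [f3], for a = 1, p and 1 - p. The factor a rescales t in the
    numerator but not in [lnker]. *)
Definition dupfun (a : R) (y : nat) (t : R) : R :=
  (1 - a * t * y%:R / (1 + p) - droot p (a * t) ^+ y) * lnker t.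

Let dupfunE a y (S t : R) :
  (1 - t * y%:R * a / (1 + p)) / (t * ln (1 - t))
  - (S - (1 - p)) ^+ y / ((2 * p) ^+ y * t * ln (1 - t))
  = (1 - a * t * y%:R / (1 + p) - ((S - (1 - p)) / (2 * p)) ^+ y) * lnker t.
Proof.
rewrite /lnker expr_div_n -[_ * t * ln _]mulrA.
rewrite [in LHS](invfM ((2 * p) ^+ y)).
set c := _ ^- y; set k := (t * _)^-1; ring.
Qed.

Lemma Lambda_f1 y : Lambda (f1 p) y = int01 (dupfun 1 y).
Proof.
apply: eq_int01 => t _; rewrite /f1 /dupfun /droot mul1r -[t in RHS]mul1r.
by rewrite -(mulr1 (t * y%:R)) dupfunE mul1r.
Qed.

Lemma Lambda_f2 y : Lambda (f2 p) y = int01 (dupfun p y).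
Proof.
apply: eq_int01 => t _; rewrite /f2 dupfunE /dupfun /droot.
by rewrite (_ : 4 * p ^+ 2 * t = 4 * p * (p * t)) //; ring.
Qed.

Lemma Lambda_f3 y : Lambda (f3 p) y = int01 (dupfun (1 - p) y).
Proof.
apply: eq_int01 => t _; rewrite /f3 dupfunE /dupfun /droot.
by rewrite (_ : 4 * p * (1 - p) * t = 4 * p * ((1 - p) * t)) //; ring.
Qed.

Lemma scale01 (a t : R) : 0 <= a <= 1 -> 0 <= t <= 1 -> 0 <= a * t <= 1.
Proof.
by move=> /andP[a0 a1] /andP[t0 t1]; rewrite mulr_ge0 //= mulr_ile1.
Qed.

Lemma measurable_droot (a : R) (y : nat) :
  measurable_fun `[0 : R, 1]%classic (fun t => droot p (a * t) ^+ y).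
Proof.
apply: measurable_funX; apply: measurable_funM => //; apply: measurable_funB => //.
apply: (measurable_funS measurableT (@subsetT _ _)).
apply: (@measurableT_comp _ _ _ _ _ _ (@Num.sqrt R)).
  by apply: continuous_measurable_fun; exact: sqrt_continuous.
apply: measurable_funB => //; apply: measurable_funM => //. 
Qed.

Lemma integrable_dupfun a y : 0 <= a <= 1 -> integrable01 (dupfun a y).
Proof.
move=> a01; apply: (@integrable_lnker_num _ _ (y%:R ^+ 2)).
  apply: measurable_funB; last exact: measurable_droot.
  apply: measurable_funB => //; apply: measurable_funM => //.
  by apply: measurable_funM => //; apply: measurable_funM.
move=> t /andP[t0 t1]; have t01 : 0 <= t <= 1 by rewrite ltW.
apply: (le_trans (droot_num_le p_gt0 p_lt1 y (scale01 a01 t01))).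
have /andP[a0 a1] := a01.
rewrite ler_wpM2l ?sqr_ge0 // ler_sqr ?nnegrE ?(ltW t0) ?mulr_ge0 ?(ltW t0) //.
by rewrite ler_piMl // ltW.
Qed.

Lemma binmean_int01 n (F : nat -> R -> R) :
  (forall k, (k <= n)%N -> integrable01 (F k)) ->
  integrable01 (fun t => binmean p n (F ^~ t)) /\
  int01 (fun t => binmean p n (F ^~ t)) = binmean p n (fun k => int01 (F k)).
Proof.
move=> hF; have [|h1 h2] := @int01_sum R n.+1 (fun k t => binmass p n k * F k t).
  by move=> k; rewrite ltnS => kn; apply: integrable01Z; exact: hF.
split => //; rewrite /binmean h2; apply: eq_bigr => k _.
by rewrite int01Z //; apply: hF; rewrite -ltnS.
Qed.

(** The root equation gives E[r ^ (x + K)] = (1 - a t) ^ x, and E[x + K] = (1 + p) x cancels the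
    denominator 1 + p of the linear term. *)
Lemma binmean_dupfun a x t : 0 <= a <= 1 -> 0 <= t <= 1 ->
  binmean p x (fun k => dupfun a (x + k) t)
  = (1 - a * t * x%:R - (1 - a * t) ^+ x) * lnker t.
Proof.
move=> a01 t01; have [_ _ rE _ _] := drootP p_gt0 p_lt1 (scale01 a01 t01).
have p1 : 1 + p != 0 by rewrite gt_eqF // addr_gt0.
rewrite (@eq_binmean _ _ _ _ (fun k => lnker t * (1 - a * t * x%:R / (1 + p)
   - a * t / (1 + p) * k%:R - droot p (a * t) ^+ x * droot p (a * t) ^+ k))); last first.
  by move=> k _; rewrite /dupfun natrD exprD; ring.
rewrite binmeanZ !binmeanB !binmean_cst !binmeanZ binmean_nat binmean_expr.
rewrite -exprMn [droot _ _ * _]mulrC rE mulrC; congr (_ * _).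
by congr (_ - _); field.
Qed.

Lemma binmean_Lambda1 x :
  binmean p x (fun k => int01 (dupfun 1 (x + k))) = ln (x`!)%:R.
Proof.
have o : 0 <= (1 : R) <= 1 by rewrite ler01 lexx.
have [|_ <-] := @binmean_int01 x (fun k => dupfun 1 (x + k)).
  by move=> k _; exact: integrable_dupfun.
rewrite -int01_lnfact; apply: eq_int01 => t t01.
by rewrite binmean_dupfun // /lnfact_fun mul1r.
Qed.

(** Since E[(1 - t) ^ K] = (1 - p t) ^ x, the kernel of ln K! has the same mean as [dupfun] with a =
    p. The case a = 1 - p below is the same for x - K. *)
Lemma binmean_Lambda2 x :
  binmean p x (fun k => int01 (dupfun p (x + k)))
  = binmean p x (fun k => ln (k`!)%:R).
Proof.
have o : (0 : R) <= p <= 1 by rewrite !ltW.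
have [|_ <-] := @binmean_int01 x (fun k => dupfun p (x + k)).
  by move=> k _; exact: integrable_dupfun.
have [|_ h] := @binmean_int01 x (fun k => @lnfact_fun R k).
  by move=> k _; exact: integrable_lnfact.
rewrite (@eq_binmean _ _ _ _ (fun k => int01 (@lnfact_fun R k))); last first.
  by move=> k _; rewrite int01_lnfact.
rewrite -h; apply: eq_int01 => t t01; rewrite binmean_dupfun //.
rewrite (@eq_binmean _ _ _ _ (fun k => lnker t * (1 - t * k%:R - (1 - t) ^+ k))); last first.
  by move=> k _; rewrite /lnfact_fun mulrC.
rewrite binmeanZ !binmeanB !binmean_cst binmeanZ binmean_nat binmean_expr mulrC.
by congr (_ * (_ - _ - _ ^+ _)); ring.
Qed.

Lemma binmean_Lambda3 x :
  binmean p x (fun k => int01 (dupfun (1 - p) (x + k)))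
  = binmean p x (fun k => ln ((x - k)`!)%:R).
Proof.
have o : (0 : R) <= 1 - p <= 1 by rewrite subr_ge0 gerBl !ltW.
have [|_ <-] := @binmean_int01 x (fun k => dupfun (1 - p) (x + k)).
  by move=> k _; exact: integrable_dupfun.
have [|_ h] := @binmean_int01 x (fun k => @lnfact_fun R (x - k)).
  by move=> k _; exact: integrable_lnfact.
rewrite (@eq_binmean _ _ _ (fun k => ln _) (fun k => int01 (@lnfact_fun R (x - k)))); last first.
  by move=> k _; rewrite int01_lnfact.
rewrite -h; apply: eq_int01 => t t01; rewrite binmean_dupfun //.
rewrite (@eq_binmean _ _ _ (fun k => lnfact_fun _ _) (fun k => lnker t * (1 - t * x%:R + t * k%:R - (1 - t) ^+ (x - k)))); last first.
  by move=> k kx; rewrite /lnfact_fun natrB //; ring.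
rewrite binmeanZ binmeanB binmeanD !binmean_cst binmeanZ binmean_nat binmean_expr_compl mulrC.
by congr (_ * (_ - _ ^+ _)); ring.
Qed.

Definition logweight (y : nat) : R :=
  Lambda (f1 p) y - Lambda (f2 p) y - Lambda (f3 p) y
  - y%:R * binary_entropy p / (1 + p).

Lemma weightE q y : weight p q y = q ^+ y * expR (logweight y).
Proof. by []. Qed.

Lemma binmean_Lambda x :
  binmean p x (fun k => Lambda (f1 p) (x + k) - Lambda (f2 p) (x + k) - Lambda (f3 p) (x + k))
  = binmean p x (fun k => ln 'C(x, k)%:R).
Proof.
rewrite (@eq_binmean _ _ _ _ (fun k => int01 (dupfun 1 (x + k))
  - int01 (dupfun p (x + k)) - int01 (dupfun (1 - p) (x + k)))); last first.
  by move=> k _; rewrite Lambda_f1 Lambda_f2 Lambda_f3.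
rewrite !binmeanB binmean_Lambda1 binmean_Lambda2 binmean_Lambda3.
rewrite -(binmean_cst p x (ln x`!%:R)) -!binmeanB; apply: eq_binmean => k kx.
have C0 : (0 : R) < 'C(x, k)%:R by rewrite ltr0n bin_gt0.
have F0 m : (0 : R) < m`!%:R by rewrite ltr0n fact_gt0.
by rewrite -(bin_fact kx) !natrM !lnM ?posrE ?mulr_gt0 //; ring.
Qed.

(** The linear term of [logweight] averages to x h(p), again by E[x + K] = (1 + p) x, and so turns
    ln C(x, K) into the log-probability of K in the mean. *)
Lemma binmean_logweight x :
  binmean p x (fun k => logweight (x + k))
  = binmean p x (fun k => ln (binmass p x k)).
Proof.
have p1 : 1 + p != 0 by rewrite gt_eqF // addr_gt0.
rewrite -binmean_ln_bin // -binmean_Lambda.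
rewrite (@eq_binmean _ _ _ (fun k => logweight _) (fun k =>
  (Lambda (f1 p) (x + k) - Lambda (f2 p) (x + k) - Lambda (f3 p) (x + k))
  - (x%:R * binary_entropy p / (1 + p) + binary_entropy p / (1 + p) * k%:R))); last first.
  by move=> k _; rewrite /logweight natrD; ring.
rewrite binmeanB; congr (_ - _).
by rewrite binmeanD !binmean_cst binmeanZ binmean_nat; field.
Qed.


(** * Sublinear growth of the log-weights *)

Section Mixture.
Variable y : nat.

Let x := Num.truncn (y%:R / (1 + p)).
Let lam := y%:R / (1 + p) - x%:R.

(* The law of x + K or x + 1 + K', mixed so that its mean is exactly y. *)
Let mixmean (G : nat -> R) : R :=
  (1 - lam) * binmean p x (fun k => G (x + k)%N)
  + lam * binmean p x.+1 (fun k => G (x.+1 + k)%N).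

Let p1_gt0 : 0 < 1 + p. Proof. exact: addr_gt0. Qed.

Let lam01 : 0 <= lam <= 1.
Proof.
have y0 : 0 <= y%:R / (1 + p) by rewrite divr_ge0 // ltW.
have /andP[l u] := truncn_itv y0.
by rewrite /lam subr_ge0 l lerBlDl ltW // natr1.
Qed.

Let eq_mixmean F G : F =1 G -> mixmean F = mixmean G.
Proof. by move=> FG; rewrite /mixmean; congr (_ * _ + _ * _); apply: eq_binmean => k _. Qed.

Let le_mixmean F G : (forall k, F k <= G k) -> mixmean F <= mixmean G.
Proof.
move=> FG; have /andP[l u] := lam01.
have l' : 0 <= 1 - lam by rewrite subr_ge0.
by apply: lerD; apply: ler_wpM2l => //; apply: (le_binmean p_gt0 p_lt1) => k _; exact: FG.
Qed.

Let mixmeanD F G : mixmean (fun k => F k + G k) = mixmean F + mixmean G.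
Proof. by rewrite /mixmean !binmeanD; ring. Qed.

Let mixmeanZ c F : mixmean (fun k => c * F k) = c * mixmean F.
Proof. by rewrite /mixmean !binmeanZ; ring. Qed.

Let mixmeanN F : mixmean (fun k => - F k) = - mixmean F.
Proof. by rewrite /mixmean !binmeanN; ring. Qed.

Let mixmean_cst c : mixmean (fun=> c) = c.
Proof. by rewrite /mixmean !binmean_cst; ring. Qed.

Let mixmean_nat : mixmean (fun k => k%:R) = y%:R.
Proof.
rewrite /mixmean.
rewrite (@eq_binmean _ _ x _ (fun k => x%:R + k%:R)); last by move=> k _; rewrite natrD.
rewrite (@eq_binmean _ _ x.+1 _ (fun k => x.+1%:R + k%:R)); last by move=> k _; rewrite natrD.
rewrite !binmeanD !binmean_cst !binmean_nat -natr1 /lam; field.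
by rewrite gt_eqF.
Qed.

(** The two variances are at most x + 1 <= y + 1, and the two means are within 1 + p < 2 of y, which
    adds at most 4. *)
Let mixmean_sqr : mixmean (fun k => (k%:R - y%:R) ^+ 2) <= y%:R + 5.
Proof.
rewrite /mixmean !binmean_sqr.
have /andP[l u] := lam01.
have yE : y%:R = (1 + p) * (x%:R + lam) by rewrite /lam; field; rewrite gt_eqF.
have x0 : (0 : R) <= x%:R by [].
have xy : x%:R <= y%:R :> R.
  rewrite yE; apply: (@le_trans _ _ (x%:R + lam)); first by rewrite lerDl.
  have h1 : 1 <= 1 + p by rewrite lerDl ltW.
  have h2 : 0 <= x%:R + lam by exact: addr_ge0.
  exact: ler_peMl.
have pq0 : 0 <= p * (1 - p) by rewrite mulr_ge0 ?subr_ge0 // ltW.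
have pq : p * (1 - p) <= 1 by move: p_gt0 p_lt1 => *; nra.
have bd (n : nat) c : n%:R <= x%:R + 1 :> R -> - (1 + p) <= c <= 1 + p ->
    n%:R * (p * (1 - p)) + c ^+ 2 <= y%:R + 5.
  move=> nx cp.
  have h1 : n%:R * (p * (1 - p)) <= n%:R by rewrite ler_piMr.
  have h2 : c ^+ 2 <= 2 ^+ 2.
    rewrite -[X in X <= _]real_normK ?num_real // ler_sqr ?nnegrE //.
    apply: (@le_trans _ _ (1 + p)); first by rewrite ler_norml.
    by rewrite (_ : 2 = 1 + 1) ?lerD2l ?ltW.
  by rewrite (_ : 2 ^+ 2 = 4) in h2; [lra|ring].
have b1 := bd x ((1 + p) * x%:R - y%:R).
have b2 := bd x.+1 ((1 + p) * x.+1%:R - y%:R).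
have {}b1 : x%:R * (p * (1 - p)) + ((1 + p) * x%:R - y%:R) ^+ 2 <= y%:R + 5.
  apply: b1; first by rewrite lerDl.
  rewrite yE (_ : _ - _ = - ((1 + p) * lam)); last by ring.
  have h : (1 + p) * lam <= 1 + p by rewrite ler_piMr // ltW.
  have h0 : 0 <= (1 + p) * lam by rewrite mulr_ge0 // ltW.
  by rewrite lerN2 h /=; move: (ltW p1_gt0) => *; lra.
have {}b2 : x.+1%:R * (p * (1 - p)) + ((1 + p) * x.+1%:R - y%:R) ^+ 2 <= y%:R + 5.
  apply: b2; first by rewrite natr1.
  rewrite yE -natr1 (_ : _ - _ = (1 + p) * (1 - lam)); last by ring.
  have h : (1 + p) * (1 - lam) <= 1 + p by rewrite ler_piMr ?(ltW p1_gt0) // gerBl.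
  have h0 : 0 <= (1 + p) * (1 - lam) by rewrite mulr_ge0 ?subr_ge0 // ltW.
  by rewrite h andbT; move: (ltW p1_gt0) => *; lra.
have l' : 0 <= 1 - lam by rewrite subr_ge0.
apply: (le_trans (lerD (ler_wpM2l l' b1) (ler_wpM2l l b2))).
by rewrite -mulrDl subrK mul1r.
Qed.

(** The Jensen gap of the convex function k -> r ^ k. *)
Let gap a t := mixmean (fun k => droot p (a * t) ^+ k) - droot p (a * t) ^+ y.

(** In the mean the linear term of [expr_tangent] vanishes, the mixture being centred at y. The
    quadratic bound serves near t = 0, where [lnker] is singular, and the bound 1 away from 0. *)
Let gap_bounds a t : 0 <= a <= 1 -> 0 <= t <= 1 ->
  [/\ 0 <= gap a t, gap a t <= 1 & gap a t <= t ^+ 2 * (y%:R + 5)].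
Proof.
move=> a01 t01; have s01 := scale01 a01 t01.
have [r0 r1 _ r2 _] := drootP p_gt0 p_lt1 s01.
have T k := expr_tangent r0 r1 y k.
rewrite /gap; set r := droot p (a * t) in r0 r1 r2 T *.
have e : mixmean (fun k => r ^+ k - r ^+ y + (k%:R - y%:R) * (1 - r) * r ^+ y)
    = mixmean (fun k => r ^+ k) - r ^+ y.
  rewrite (@eq_mixmean _ (fun k => (r ^+ k + (- r ^+ y - y%:R * (1 - r) * r ^+ y)) + ((1 - r) * r ^+ y) * k%:R)).
    by rewrite !mixmeanD !mixmean_cst mixmeanZ mixmean_nat; ring.
  by move=> k; ring.
split.
- rewrite -e -(mixmean_cst 0); apply: le_mixmean => k; by case/andP: (T k).
- rewrite lerBlDr -(mixmean_cst (1 + r ^+ y)); apply: le_mixmean => k.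
  by rewrite (@le_trans _ _ 1) ?exprn_ile1 // lerDl exprn_ge0.
- rewrite -e; apply: (@le_trans _ _ (mixmean (fun k => (1 - r) ^+ 2 * (k%:R - y%:R) ^+ 2))).
    by apply: le_mixmean => k; rewrite [leRHS]mulrC; case/andP: (T k).
  rewrite mixmeanZ; apply: ler_pM; rewrite ?sqr_ge0 //.
    by rewrite -(mixmean_cst 0); apply: le_mixmean => k; rewrite sqr_ge0.
  have /andP[a0 a1] := a01; have /andP[t0 t1] := t01.
  by rewrite ler_sqr ?nnegrE ?subr_ge0 // (le_trans r2) // ler_piMl.
Qed.

Let mixmean_dupfun a t : 0 <= a <= 1 -> 0 <= t <= 1 ->
  mixmean (fun k => dupfun a k t) = dupfun a y t - gap a t * lnker t.
Proof.
move=> a01 t01.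
rewrite (@eq_mixmean _ (fun k => (lnker t * (1 + (- (a * t / (1 + p)) * k%:R - droot p (a * t) ^+ k))))).
  by rewrite mixmeanZ !mixmeanD !mixmean_cst mixmeanZ mixmeanN mixmean_nat /dupfun /gap; ring.
by move=> k; rewrite /dupfun; ring.
Qed.

Let mixmean_int01 a : 0 <= a <= 1 ->
  integrable01 (fun t => mixmean (fun k => dupfun a k t)) /\
  int01 (fun t => mixmean (fun k => dupfun a k t)) = mixmean (fun k => int01 (dupfun a k)).
Proof.
move=> a01.
have [|i1 e1] := @binmean_int01 x (fun k => dupfun a (x + k)).
  by move=> k _; exact: integrable_dupfun.
have [|i2 e2] := @binmean_int01 x.+1 (fun k => dupfun a (x.+1 + k)).
  by move=> k _; exact: integrable_dupfun.
rewrite /mixmean -e1 -e2; split.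
  by apply: integrable01D; apply: integrable01Z.
by rewrite int01D ?int01Z //; apply: integrable01Z.
Qed.

Let Lambda_mix_lower a : 0 <= a <= 1 ->
  int01 (dupfun a y) <= mixmean (fun k => int01 (dupfun a k)).
Proof.
move=> a01; have [i e] := mixmean_int01 a01; rewrite -e.
apply: le_int01 => //; first exact: integrable_dupfun.
move=> t /andP[t0 t1]; have t01 : 0 <= t <= 1 by rewrite ltW.
rewrite mixmean_dupfun // lerDl oppr_ge0 mulr_ge0_le0 ?lnker_le0 //.
by have [] := gap_bounds a01 t01.
Qed.

Let integrable_onemX n : integrable01 (fun t : R => (1 - t) ^+ n).
Proof.
apply: (@bounded_integrable01 _ _ 1).
  by apply: measurable_funX; exact: measurable_funB.
move=> t /andP[t0 t1]; rewrite ger0_norm ?exprn_ge0 ?subr_ge0 //.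
by rewrite exprn_ile1 ?subr_ge0 // gerBl.
Qed.

(** One majorant covers both ranges of t. If 2 n t <= 1, the error is at most y + 5, and Bernoulli's
    inequality gives 1 <= 2 (1 - t) ^ n, whose integral is 2 / (n + 1). If 2 n t > 1, it is at most
    t ^ -2 < 4 n ^ 2. *)
Let Lambda_mix_upper a n : 0 <= a <= 1 ->
  mixmean (fun k => int01 (dupfun a k)) <= int01 (dupfun a y)
    + (2 * (y%:R + 5) / n.+1%:R + 4 * n%:R ^+ 2).
Proof.
move=> a01; have [i e] := mixmean_int01 a01; rewrite -e.
have onem : int01 (fun t : R => (1 - t) ^+ n) = n.+1%:R^-1.
  exact: Rintegral_onemXn.
rewrite -onem -int01Z // -[4 * _](int01_cst (4 * n%:R ^+ 2 : R)) -!int01D //;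
  try by [exact: integrable01_cst|exact: integrable01Z|exact: integrable_dupfun
         |apply: integrable01D; [exact: integrable01Z|exact: integrable01_cst]].
apply: le_int01 => //.
  apply: integrable01D; first exact: integrable_dupfun.
  by apply: integrable01D; [exact: integrable01Z|exact: integrable01_cst].
move=> t /andP[t0 t1]; have t01 : 0 <= t <= 1 by rewrite ltW.
rewrite mixmean_dupfun // lerD2l -mulrN.
have [g0 g1 g2] := gap_bounds a01 t01.
have t2 : 0 < t ^+ 2 by rewrite exprn_gt0.
have t01' : 0 < t <= 1 by rewrite t0.
have k0 : 0 <= - lnker t by rewrite oppr_ge0 lnker_le0.
have k1 := lnker_ge t01'.
have y5 : (0 : R) <= y%:R + 5 by rewrite addr_ge0.
have b0 : 0 <= (1 - t) ^+ n by rewrite exprn_ge0 // subr_ge0.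
have n2 : (0 : R) <= 4 * n%:R ^+ 2 by rewrite mulr_ge0 // sqr_ge0.
case: (lerP (2 * n%:R * t) 1) => nt.
  apply: (@le_trans _ _ (y%:R + 5)).
    apply: (@le_trans _ _ (t ^+ 2 * (y%:R + 5) * (t ^+ 2)^-1)).
      by apply: ler_pM.
    by rewrite mulrAC divff ?mul1r // gt_eqF.
  have /andP[B _] := @expr_ge_tangent1 _ (1 - t) ltac:(by rewrite subr_ge0) ltac:(by rewrite gerBl ltW) n.
  rewrite subKr in B.
  have B' : 1 <= 2 * (1 - t) ^+ n by lra.
  apply: (@le_trans _ _ (2 * (y%:R + 5) * (1 - t) ^+ n)); last by rewrite lerDl.
  by rewrite mulrAC ler_peMl.
apply: (@le_trans _ _ (4 * n%:R ^+ 2)); last by rewrite lerDr !mulr_ge0.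
apply: (@le_trans _ _ (1 * (t ^+ 2)^-1)); first by apply: ler_pM.
rewrite mul1r -[_^-1]mul1r ler_pdivrMr //.
rewrite (_ : 4 * n%:R ^+ 2 * t ^+ 2 = (2 * n%:R * t) ^+ 2); last by ring.
by rewrite exprn_ege1 // ltW.
Qed.

(** Passing from the mixture to y can only decrease Lambda_1, and decreases Lambda_2 and Lambda_3 by
    at most the error of [Lambda_mix_upper], counted twice here; the linear term is unchanged. The
    mean of [logweight] over the mixture is at most 0. *)
Lemma logweight_le n : logweight y <= 4 * (y%:R + 5) / n.+1%:R + 8 * n%:R ^+ 2.
Proof.
have m0 : mixmean logweight <= 0.
  have /andP[l u] := lam01.
  rewrite /mixmean !binmean_logweight.
  have := binmean_ln_mass_le0 p_gt0 p_lt1 x.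
  have := binmean_ln_mass_le0 p_gt0 p_lt1 x.+1.
  set b1 := binmean _ _ _; set b2 := binmean _ _ _ => h1 h2.
  have l' : 0 <= 1 - lam by rewrite subr_ge0.
  by have := mulr_ge0_le0 l' h2; have := mulr_ge0_le0 l h1; lra.
have m1 : mixmean logweight = mixmean (fun k => int01 (dupfun 1 k))
    - mixmean (fun k => int01 (dupfun p k)) - mixmean (fun k => int01 (dupfun (1 - p) k))
    - y%:R * binary_entropy p / (1 + p).
  rewrite (@eq_mixmean _ (fun k => int01 (dupfun 1 k) + (- int01 (dupfun p k)
    + (- int01 (dupfun (1 - p) k) + (- (binary_entropy p / (1 + p))) * k%:R)))).
    by rewrite !mixmeanD !mixmeanN mixmeanZ mixmean_nat; ring.
  by move=> k; rewrite /logweight Lambda_f1 Lambda_f2 Lambda_f3; ring.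
have o1 : 0 <= (1 : R) <= 1 by rewrite ler01 lexx.
have o2 : (0 : R) <= p <= 1 by rewrite !ltW.
have o3 : (0 : R) <= 1 - p <= 1 by rewrite subr_ge0 gerBl !ltW.
rewrite m1 in m0; move: m0.
have := Lambda_mix_lower o1; have := Lambda_mix_upper n o2; have := Lambda_mix_upper n o3.
rewrite /logweight Lambda_f1 Lambda_f2 Lambda_f3.
have -> : 4 * (y%:R + 5) / n.+1%:R = 2 * (2 * (y%:R + 5) / n.+1%:R) :> R by ring.
set M3 := mixmean _; set M2 := mixmean _; set M1 := mixmean _.
set V := 2 * _ / _; set N2 := _ ^+ 2; set z := _ * _ / (1 + p).
move: M1 M2 M3 (int01 _) (int01 _) (int01 _) V N2 z => *; lra.
Qed.

End Mixture.

Lemma logweight_sublinear (e : R) : 0 < e ->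
  exists C : R, forall y, logweight y <= e * y%:R + C.
Proof.
move=> e0; set n := Num.truncn (4 / e).
have h : 4 / n.+1%:R <= e.
  rewrite ler_pdivrMr ?ltr0n // -ler_pdivrMl // mulrC.
  by rewrite ltW // truncnS_gt.
exists (5 * e + 8 * n%:R ^+ 2) => y; apply: (le_trans (logweight_le y n)).
rewrite [leRHS]addrA lerD2r mulrAC; apply: (@le_trans _ _ (e * (y%:R + 5))).
  by rewrite ler_wpM2r // addr_ge0.
by rewrite mulrDr [5 * e]mulrC.
Qed.

(* Jensen's inequality and H <= ln (x + 1). *)
Lemma binmean_expR_logweight x :
  x.+1%:R^-1 <= binmean p x (fun k => expR (logweight (x + k))).
Proof.
set c := x.+1%:R^-1; have c0 : 0 < c by rewrite invr_gt0 ltr0n.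
have := binmean_ln_mass_ge p_gt0 p_lt1 x; rewrite -binmean_logweight // => h.
have lnc : ln c = - ln x.+1%:R by rewrite lnV // posrE ltr0n.
apply: (@le_trans _ _ (binmean p x (fun k => c * (1 - ln c + logweight (x + k))))).
  rewrite binmeanZ binmeanD binmean_cst lnc opprK -[X in X <= _]mulr1.
  by rewrite ler_pM2l //; lra.
apply: le_binmean => // k _.
have -> : expR (logweight (x + k)) = c * expR (logweight (x + k) - ln c).
  by rewrite expRB lnK ?posrE // mulrCA divff ?mulr1 // gt_eqF.
rewrite ler_pM2l // (le_trans _ (expR_ge1Dx _)) //; lra.
Qed.

Lemma sum_expR_logweight_ge N :
  \sum_(x < N) (x.+1%:R : R)^-1 <= \sum_(y < N.*2) expR (logweight y).
Proof.
apply: le_trans (@binmean_renewal _ _ p_gt0 p_lt1 N _ (fun y => expR_ge0 (logweight y))).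
by apply: ler_sum => x _; exact: binmean_expR_logweight.
Qed.

End LogWeight.

(** * Generating series and the mean of the output law *)

Section SubexponentialSeries.
Context {R : realType}.
Implicit Types (a b : R^nat) (q : R).

(** Equivalent to a radius of convergence at least 1, in a form that passes directly to shifts and
    formal derivatives. *)
Definition subexponential a :=
  forall e : R, 0 < e -> exists C : R, forall k, `|a k| <= C * expR (e * k%:R).

Lemma subexponential_le a b (M : R) : 0 <= M -> (forall k, `|b k| <= M * `|a k|) ->
  subexponential a -> subexponential b.
Proof.
move=> M0 ba sa e e0; have [C hC] := sa e e0; exists (M * C) => k.
by rewrite (le_trans (ba k)) // -mulrA ler_wpM2l.
Qed.

(** Half of the exponent e absorbs the factor k + 1, through 1 + e k / 2 <= exp (e k / 2). *)
Lemma subexponential_mulS a : subexponential a ->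
  subexponential (fun k => k.+1%:R * a k).
Proof.
move=> sa e e0; have e2 : 0 < e / 2 by rewrite divr_gt0.
have [C hC] := sa _ e2; exists ((1 + (e / 2)^-1) * C) => k.
rewrite normrM ger0_norm // -mulrA.
apply: (@le_trans _ _ (((1 + (e / 2)^-1) * expR (e / 2 * k%:R)) * (C * expR (e / 2 * k%:R)))).
  apply: ler_pM => //.
  apply: (@le_trans _ _ ((1 + (e / 2)^-1) * (1 + e / 2 * k%:R))); last first.
    by rewrite ler_wpM2l ?expR_ge1Dx // addr_ge0 // invr_ge0 ltW.
  rewrite -natr1 [leRHS](_ : _ = k%:R + 1 + (e / 2 * k%:R + (e / 2)^-1)); last first.
    by field; rewrite gt_eqF.
  by rewrite lerDl addr_ge0 ?invr_ge0 // ?mulr_ge0 // ltW.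
rewrite -mulrA ler_wpM2l ?addr_ge0 ?invr_ge0 ?(ltW e2) //.
rewrite mulrCA -expRD (_ : e / 2 * k%:R + e / 2 * k%:R = e * k%:R) //; by field.
Qed.

Lemma subexponentialS a : subexponential a -> subexponential (fun k => a k.+1).
Proof.
move=> sa e e0; have [C hC] := sa e e0; exists (C * expR e) => k.
rewrite (le_trans (hC k.+1)) // -mulrA -expRD -natr1.
by rewrite (_ : e * (k%:R + 1) = e + e * k%:R) //; ring.
Qed.

Lemma subexponential_diffs a : subexponential a -> subexponential (pseries_diffs a).
Proof. by move=> /subexponentialS/subexponential_mulS. Qed.

Lemma is_cvg_subexponential a q : subexponential a -> 0 < q < 1 -> cvgn (pseries a q).
Proof.
move=> sa /andP[q0 q1].
have lq : ln q < 0 by rewrite ln_lt0 // q0.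
have e0 : 0 < - ln q / 2 by rewrite divr_gt0 // oppr_gt0.
have [C hC] := sa _ e0.
have C0 : 0 <= C.
  by have := hC 0; rewrite mulr0 expR0 mulr1; apply: le_trans.
set z := expR (ln q / 2); have z1 : z < 1 by rewrite -[ltRHS]expR0 ltr_expR; move: lq; set l := ln q => ?; lra.
have zE k : expR (- ln q / 2 * k%:R) * q ^+ k = z ^+ k.
  rewrite -{2}(@lnK _ q) ?posrE // -!expRM_natl -expRD; congr expR; by field.
apply: normed_cvg; apply: (@series_le_cvg _ _ (geometric C z)).
- by move=> k; exact: normr_ge0.
- by move=> k; rewrite /= mulr_ge0 // exprn_ge0 // expR_ge0.
- move=> k /=; rewrite normrM [`|q ^+ k|]ger0_norm ?exprn_ge0 ?(ltW q0) //.
  by rewrite -zE mulrA ler_wpM2r // exprn_ge0 // ltW.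
- by apply: is_cvg_geometric_series; rewrite ger0_norm ?expR_ge0.
Qed.

(** The sum is even differentiable: the series and its first two formal derivatives converge at K,
    the midpoint of |q| and 1. *)
Lemma continuous_subexponential a q : subexponential a -> `|q| < 1 ->
  {for q, continuous (fun x => limn (pseries a x))}.
Proof.
move=> sa q1; set K := (`|q| + 1) / 2.
have K01 : 0 < K < 1 by have := normr_ge0 q; rewrite /K => ?; apply/andP; split; lra.
have sd := subexponential_diffs sa; have sdd := subexponential_diffs sd.
apply: (is_derive_continuous (pseries_snd_diffs (is_cvg_subexponential sa K01)
  (is_cvg_subexponential sd K01) (is_cvg_subexponential sdd K01) _)).
by case/andP: K01 => K0 _; rewrite (gtr0_norm K0) /K; lra.
Qed.

Lemma pseries_at0 a : limn (pseries a 0) = a 0.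
Proof.
apply: cvg_lim => //; rewrite -cvg_shiftS /=.
rewrite (_ : (fun n => pseries a 0 n.+1) = fun=> a 0); first exact: cvg_cst.
apply/funext => n; rewrite /pseries /series /= big_nat_recl //= expr0 mulr1.
by rewrite big1 ?addr0 // => i _; rewrite expr0n mulr0.
Qed.

(** Signs are restricted only from N on, because the coefficients (k + 1 - mu) w_k used below may be
    negative at first. *)
Lemma pseries_ge_partial a q N : subexponential a -> 0 < q < 1 ->
  (forall k, (N <= k)%N -> 0 <= a k) ->
  \sum_(k < N) a k * q ^+ k <= limn (pseries a q).
Proof.
move=> sa q01 a0; apply: limr_ge; first exact: is_cvg_subexponential.
near=> n; rewrite /pseries /series /= -(big_mkord xpredT (fun k => a k * q ^+ k)).
rewrite (@big_cat_nat _ _ _ N 0 n) //=; last by near: n; exact: nbhs_infty_ge.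
rewrite lerDl big_nat_cond sumr_ge0 // => k /andP[/andP[Nk _] _].
by rewrite mulr_ge0 ?a0 // exprn_ge0 // ltW //; case/andP: q01.
Unshelve. all: by end_near. Qed.

Lemma eseries_shift (f : nat -> R) : (forall k, 0 <= f k.+1) ->
  cvgn (series (fun k => f k.+1)) ->
  (\sum_(1 <= k <oo) (f k)%:E = (limn (series (fun k => f k.+1)))%:E)%E.
Proof.
(* The sign of [f 0] is unknown and it does not enter the sum, so it is replaced by 0. *)
move=> f0 cf; pose g k := if k is k'.+1 then f k else 0.
have -> : (\sum_(1 <= k <oo) (f k)%:E = \sum_(1 <= k <oo) (g k)%:E)%E.
  by congr (limn _); apply/funext => n; apply: eq_big_nat => -[|k].
rewrite -(nneseries_addn 1); last by case=> [|k]; rewrite lee_fin //=.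
rewrite -EFin_lim //; congr (limn _); apply/funext => n /=.
rewrite /series /= -sumEFin; apply: eq_bigr => k _.
by rewrite addn1.
Qed.

End SubexponentialSeries.

Section Normalization.
Context {R : realType}.
Variable p : R.
Hypotheses (p_gt0 : 0 < p) (p_lt1 : p < 1).

(** Index k stands for y = k + 1, which leaves a factor q outside the power series: 1 / y_0 = q
    Z(q). *)
Let w (k : nat) : R := expR (logweight p k.+1).

Let w_gt0 k : 0 < w k. Proof. exact: expR_gt0. Qed.

Let subexp_w : subexponential w.
Proof.
move=> e e0; have [C hC] := logweight_sublinear p_gt0 p_lt1 e0.
exists (expR (e + C)) => k; rewrite ger0_norm ?expR_ge0 // -expRD ler_expR.
by rewrite (le_trans (hC _)) // -natr1; lra.
Qed.

Let subexp_w1 : subexponential (fun k => k.+1%:R * w k).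
Proof. exact: subexponential_mulS. Qed.

Let Z q := limn (pseries w q).
Let Z1 q := limn (pseries (fun k => k.+1%:R * w k) q).

Let Z_gt0 q : 0 < q < 1 -> 0 < Z q.
Proof.
move=> q01; apply: (@lt_le_trans _ _ (w 0)); first exact: w_gt0.
have := @pseries_ge_partial _ w q 1 subexp_w q01 (fun k _ => ltW (w_gt0 k)).
by rewrite big_ord1 expr0 mulr1.
Qed.

Lemma inv_y0E q : 0 < q < 1 -> inv_y0 p q = (q * Z q)%:E.
Proof.
move=> q01; have /andP[q0 q1] := q01.
have E : (fun k => weight p q k.+1) = q *: (fun k => w k * q ^+ k).
  apply/funext => k; rewrite [RHS](_ : _ = q * (w k * q ^+ k)) //.
  by rewrite weightE exprS /w; ring.
rewrite /inv_y0 eseries_shift.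
- rewrite E lim_seriesZ //; exact: is_cvg_subexponential.
- by move=> k; rewrite weightE mulr_ge0 ?expR_ge0 ?exprn_ge0 ?ltW.
- by rewrite E; apply: is_cvg_seriesZ; exact: is_cvg_subexponential.
Qed.

Lemma y0E q : 0 < q < 1 -> y0 p q = (q * Z q)^-1.
Proof. by move=> q01; rewrite /y0 inv_y0E. Qed.

Lemma y0_gt0 q : 0 < q < 1 -> 0 < y0 p q.
Proof.
by move=> q01; rewrite y0E // invr_gt0 mulr_gt0 ?Z_gt0 //; case/andP: q01.
Qed.

Lemma mean_YE q : 0 < q < 1 -> mean_Y p q = Z1 q / Z q.
Proof.
move=> q01; have /andP[q0 q1] := q01.
have E : (fun k => y0 p q * k.+1%:R * weight p q k.+1)
    = (y0 p q * q) *: (fun k => k.+1%:R * w k * q ^+ k).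
  apply/funext => k; rewrite [RHS](_ : _ = y0 p q * q * (k.+1%:R * w k * q ^+ k)) //.
  by rewrite weightE exprS /w; ring.
rewrite /mean_Y (@eseries_shift _ (fun y => y0 p q * y%:R * weight p q y)).
- rewrite E lim_seriesZ /=; last exact: is_cvg_subexponential.
  have -> : y0 p q * q = (Z q)^-1.
    by rewrite y0E // invfM mulrAC mulVf ?mul1r // gt_eqF.
  by rewrite [RHS]mulrC.
- by move=> k; rewrite weightE !mulr_ge0 ?expR_ge0 ?exprn_ge0 ?ltW ?y0_gt0.
- by rewrite E; apply: is_cvg_seriesZ; exact: is_cvg_subexponential.
Qed.

Lemma sum_weight_le1 q N : 0 < q < 1 ->
  \sum_(k < N) y0 p q * weight p q k.+1 <= 1.
Proof.
move=> q01; have /andP[q0 q1] := q01.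
rewrite -mulr_sumr y0E // mulrC ler_pdivrMr ?mul1r ?mulr_gt0 ?Z_gt0 //.
rewrite (eq_bigr (fun k : 'I_N => q * (w k * q ^+ k))); last first.
  by move=> k _; rewrite weightE exprS /w; ring.
rewrite -mulr_sumr ler_pM2l //.
by apply: pseries_ge_partial => // k _; exact: ltW.
Qed.

Let sum_w_unbounded (B : R) : exists N, B <= \sum_(k < N) w k.
Proof.
(* The lower bound on partial sums includes the term y = 0, which is not among the [w k]; it is
   added to the target B beforehand. *)
pose M := (Num.truncn (expR (B + expR (logweight p 0)))).+1.
have hM : B + expR (logweight p 0) <= \sum_(x < M) (x.+1%:R : R)^-1.
  have /andP[_] := @ln_harmonic_bounds R 1 M isT.
  rewrite (eq_bigr (fun x : 'I_M => x.+1%:R^-1)); last by move=> x _; rewrite add1n.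
  apply: le_trans; rewrite divr1 -ler_expR lnK ?posrE ?ltr0n //.
  by rewrite ltW // (lt_trans (truncnS_gt _)) // ltr_nat.
exists M.*2.-1; have := le_trans hM (sum_expR_logweight_ge p_gt0 p_lt1 M).
by rewrite doubleS /= big_ord_recl addrC lerD2l.
Qed.

(* Intermediate value theorem for sum_k (k + 1 - mu) w_k q ^ k: negative at
   q = 0, positive near q = 1 since the w_k are not summable. *)
Lemma mean_Y_surj (mu : R) : 1 < mu -> exists2 q, 0 < q < 1 & mean_Y p q = mu.
Proof.
move=> mu1; pose c (k : nat) : R := (k.+1%:R - mu) * w k.
have mu0 : 0 < mu by apply: lt_trans mu1.
have subexp_c : subexponential c.
  apply: (subexponential_le (M := 1 + mu) _ _ subexp_w1); first by rewrite addr_ge0 // ltW.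
  move=> k; rewrite /c !normrM mulrA ler_wpM2r //.
  rewrite (le_trans (ler_normB _ _)) // (gtr0_norm mu0) ger0_norm // mulrDl mul1r lerD2l.
  by rewrite ler_peMr ?(ltW mu0) // ler1n.
have cE q : 0 < q < 1 -> limn (pseries c q) = Z1 q - mu * Z q.
  move=> q01; have c1 := is_cvg_subexponential subexp_w1 q01.
  have c2 := is_cvg_subexponential subexp_w q01.
  have -> : pseries c q = series ((fun k => k.+1%:R * w k * q ^+ k) - mu *: (fun k => w k * q ^+ k)).
    congr series; apply/funext => k.
    rewrite [RHS](_ : _ = k.+1%:R * w k * q ^+ k - mu * (w k * q ^+ k)) //.
    by rewrite /= /c; ring.
  rewrite lim_seriesB; [by rewrite lim_seriesZ|exact: c1|].
  by have := @is_cvg_seriesZ _ _ mu c2; apply.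
suff [q q01 q_eq0] : exists2 q, 0 < q < 1 & limn (pseries c q) = 0.
  exists q => //; rewrite mean_YE //; move: q_eq0; rewrite cE // => /subr0_eq ->.
  by rewrite mulfK // gt_eqF // Z_gt0.
pose m := (Num.truncn mu).+1.
have mum : mu < m%:R by exact: truncnS_gt.
have c_ge0 k : (m <= k)%N -> 0 <= c k.
  move=> mk; rewrite mulr_ge0 ?expR_ge0 // subr_ge0 (le_trans (ltW mum)) // ler_nat.
  exact: leqW.
have [N0 hN0] := sum_w_unbounded (\sum_(k < m) mu * w k + 1).
pose N := (N0 + m)%N.
(* The factor k + 1 - mu is at least 1 - mu for k < m and at least 1 for k >= m, so it suffices that
   the sum of the [w k] exceeds mu times its first m terms. *)
have sum_c : 0 < \sum_(k < N) c k.
  have hN : \sum_(k < m) mu * w k + 1 <= \sum_(k < N) w k.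
    rewrite (le_trans hN0) // /N big_split_ord /= lerDl sumr_ge0 // => k _; exact: ltW.
  apply: (@lt_le_trans _ _ (\sum_(k < N) w k - \sum_(k < m) mu * w k)); first by lra.
  rewrite lerBlDr /N addnC !big_split_ord /= addrAC -big_split /=.
  apply: lerD; apply: ler_sum => k _ /=; rewrite /c.
    by rewrite -mulrDl subrK ler_peMl ?(ltW (w_gt0 _)) // ler1n.
  rewrite ler_peMl ?(ltW (w_gt0 _)) // lerBrDr.
  apply: (@le_trans _ _ (1 + m%:R)); first by rewrite lerD2l ltW.
  by rewrite nat1r ler_nat ltnS leq_addr.
(* The series itself need not converge at 1. Positivity moves from 1 to some K < 1 through the
   polynomial of the first N terms, and the remaining terms are nonnegative. *)
have [K K01 hK] : exists2 K, 0 < K < 1 & 0 < limn (pseries c K).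
  have cP : {for 1, continuous (fun x : R => \sum_(k < N) c k * x ^+ k)}.
    suff : continuous (fun x : R => \sum_(k < N) c k * x ^+ k) by apply.
    apply: continuous_big => [|k _ x]; first exact: add_continuous.
    by apply: cvgM; [exact: cvg_cst|exact: exprn_continuous].
  have P1 : 0 < \sum_(k < N) c k * 1 ^+ k.
    by under eq_bigr do rewrite expr1n mulr1.
  have near1 : \forall x \near (1 : R), 0 < \sum_(k < N) c k * x ^+ k.
    by apply: (cvgr_gt _ cP).
  move/nbhs_ballP : near1 => [e /= e0 he].
  pose K := Num.max 2^-1 (1 - e / 2).
  have K0 : 0 < K by rewrite /K lt_max invr_gt0 ltr0n.
  have K1 : K < 1 by rewrite /K gt_max invf_lt1 ?ltr1n //= gtrBl divr_gt0.
  exists K; first by rewrite K0.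
  apply: (@lt_le_trans _ _ (\sum_(k < N) c k * K ^+ k)); last first.
    apply: pseries_ge_partial; rewrite ?K0 // => k Nk; apply: c_ge0.
    by rewrite (leq_trans _ Nk) // leq_addl.
  apply: he; rewrite /ball /= ger0_norm ?subr_ge0 ?(ltW K1) // ltrBlDr -ltrBlDl.
  by rewrite (@lt_le_trans _ _ (1 - e / 2)) // ?le_max ?lexx ?orbT // ltrD2l ltrN2 gtr_pMr // invf_lt1 // ltr1n.
have /andP[K0 K1] := K01.
have c0 : limn (pseries c 0) < 0.
  by rewrite pseries_at0 /c pmulr_llt0 ?w_gt0 // subr_lt0.
have [q] : exists2 q, q \in `[0, K] & limn (pseries c q) = 0.
  apply: IVT; first exact: ltW.
    apply: continuous_in_subspaceT => q; rewrite inE /= in_itv /= => /andP[q0 qK].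
    by apply: continuous_subexponential => //; rewrite ger0_norm // (le_lt_trans qK).
  by rewrite ge_min le_max (ltW c0) (ltW hK) orbT.
rewrite in_itv /= => /andP[q0 qK] hq; exists q => //.
rewrite (le_lt_trans qK K1) andbT lt_neqAle q0 andbT eq_sym.
by apply/eqP => q_eq0; rewrite -{1}q_eq0 hq ltxx in c0.
Qed.

End Normalization.

(** * The converse for codes *)

Section RunLengths.

Fixpoint unruns (b : bool) (ls : seq nat) : seq bool :=
  if ls is l :: ls' then nseq l b ++ unruns (~~ b) ls' else [::].

Lemma runsP (x : seq bool) : x != [::] -> exists b ls,
  [/\ x = unruns b ls, all (leq 1) ls, sumn ls = size x & (0 < size ls)%N].
Proof.
elim: x => // c [|c' x] IH _; first by exists c, [:: 1%N].
have [//|b [ls0 [xE ls1 sE]]] := IH.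
case: ls0 xE ls1 sE => [//|l ls] xE /= /andP[l0 ls0] sE _.
have [cb|cb] := eqVneq c b.
  exists b, (l.+1 :: ls); split; rewrite //= ?ls0 ?addSn ?sE //.
  by rewrite xE cb.
exists c, (1%N :: l :: ls); split; rewrite //= ?l0 ?ls0 ?sE //.
have -> : ~~ c = b by case: (c) (b) cb => [] [].
by rewrite xE.
Qed.

(** [repeat_output] without the tuple types, so that strings can be cut at run boundaries. *)
Definition outstring (x : seq bool) (d : seq nat) : seq bool :=
  flatten [seq nseq xd.2 xd.1 | xd <- zip x d].

Lemma outstring_nseq_cat l b x d1 d2 : size d1 = l ->
  outstring (nseq l b ++ x) (d1 ++ d2) = nseq (sumn d1) b ++ outstring x d2.
Proof.
elim: l d1 => [|l IH] [|a d1] //= [sd].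
rewrite /outstring /= -/(outstring _ _) IH // catA; congr (_ ++ _).
by rewrite -nseqD.
Qed.

Lemma size_le_sumn ls : all (leq 1) ls -> (size ls <= sumn ls)%N.
Proof. by elim: ls => //= l ls IH /andP[l0 /IH]; rewrite -add1n; apply: leq_add. Qed.

End RunLengths.

Section Channel.
Context {R : realType}.
Variable p : R.
Hypotheses (p_gt0 : 0 < p) (p_lt1 : p < 1).

(** Expectation over n independent replication counts, as a recursion so that it splits along
    concatenation. *)
Fixpoint dupmean (n : nat) (F : seq nat -> R) : R :=
  if n is n'.+1 then (1 - p) * dupmean n' (fun d => F (1%N :: d))
                     + p * dupmean n' (fun d => F (2%N :: d))
  else F [::].

Fixpoint dupwords (n : nat) : seq (seq nat) :=
  if n is n'.+1 then [seq 1%N :: d | d <- dupwords n'] ++ [seq 2%N :: d | d <- dupwords n']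
  else [:: [::]].

Lemma eq_dupmean n (F G : seq nat -> R) :
  (forall d, size d = n -> F d = G d) -> dupmean n F = dupmean n G.
Proof.
elim: n F G => [|n IH] F G FG /=; first exact: FG.
by congr (_ * _ + _ * _); apply: IH => d sd; apply: FG; rewrite /= sd.
Qed.

Lemma dupmean_cat n m (F : seq nat -> R) :
  dupmean (n + m) F = dupmean n (fun d1 => dupmean m (fun d2 => F (d1 ++ d2))).
Proof. by elim: n F => [|n IH] F //=; rewrite !IH. Qed.

Lemma dupmean_compl n (g : pred (seq nat)) :
  dupmean n (fun d => (~~ g d)%:R) = 1 - dupmean n (fun d => (g d)%:R).
Proof.
elim: n g => [|n IH] g /=; first by case: (g _); rewrite ?subrr ?subr0.
by rewrite (IH (fun d => g (1%N :: d))) (IH (fun d => g (2%N :: d))); ring.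
Qed.

Lemma dupmean_sumn l (G : nat -> R) :
  dupmean l (fun d => G (sumn d)) = binmean p l (fun k => G (l + k)%N).
Proof.
elim: l G => [|l IH] G /=; first by rewrite binmean0.
rewrite (IH (fun s => G (1 + s)%N)) (IH (fun s => G (2 + s)%N)) binmeanS.
by congr (_ * _ + _ * _); apply: eq_binmean => k _; rewrite ?addnS.
Qed.

Lemma size_dupwords n d : d \in dupwords n -> size d = n.
Proof.
elim: n d => [|n IH] d /=; first by rewrite inE => /eqP ->.
by rewrite mem_cat => /orP[] /mapP[d' /IH <- ->].
Qed.

Lemma uniq_dupwords n : uniq (dupwords n).
Proof.
elim: n => //= n IH; rewrite cat_uniq !map_inj_uniq ?IH //=; try by move=> ? ? [].
rewrite andbT; apply/hasPn => _ /mapP[d _ ->]; apply/negP.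
by case/mapP.
Qed.

Lemma dupmeanE n (F : seq nat -> R) :
  dupmean n F = \sum_(d <- dupwords n) (\prod_(k <- d) duplication_dist p k) * F d.
Proof.
elim: n F => [|n IH] F /=; first by rewrite big_seq1 big_nil mul1r.
rewrite big_cat !big_map !IH !mulr_sumr.
by congr (_ + _); apply: eq_bigr => d _; rewrite big_cons /duplication_dist /=; ring.
Qed.

(** The extended sum dominates its restriction to the finitely many count vectors with entries 1 and
    2. A lower bound on the error is all that a converse asks. *)
Lemma error_prob_ge n M (enc : 'I_M -> n.-tuple bool) (dec : seq bool -> 'I_M) m :
  ((1 - dupmean n (fun d => (dec (outstring (enc m) d) == m)%:R))%:E
    <= error_prob (duplication_dist p) enc dec m)%E.
Proof.
rewrite -dupmean_compl dupmeanE; apply: esum_ge.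
pose wrong (d : seq nat) := dec (outstring (enc m) d) != m.
pose L : seq (n.-tuple nat) := pmap insub [seq d <- dupwords n | wrong d].
have valL : [seq val d | d <- L] = [seq d <- dupwords n | wrong d].
  rewrite /L pmap_filter; last by move=> d; exact: insubK.
  apply/all_filterP/allP => d; rewrite mem_filter => /andP[_ dn].
  by rewrite isSome_insub; apply/eqP/size_dupwords.
exists [set` L].
  split; first exact: finite_seq.
  move=> d /= dL; have : val d \in [seq val d | d <- L] by apply: map_f.
  by rewrite valL mem_filter => /andP[].
rewrite -fsbig_seq; last first.
  by rewrite pmap_sub_uniq // filter_uniq // uniq_dupwords.
rewrite sumEFin lee_fin le_eqVlt; apply/orP; left; apply/eqP.
rewrite -(big_map val xpredT (fun d : seq nat => \prod_(k <- d) duplication_dist p k)).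
rewrite valL big_filter [RHS]big_mkcond /=; apply: eq_bigr => d _.
by rewrite /wrong; case: (dec _ == _); rewrite ?mulr0 ?mulr1.
Qed.

Fixpoint runsmean (ls : seq nat) (G : seq nat -> R) : R :=
  if ls is l :: ls' then
    binmean p l (fun k => runsmean ls' (fun ys => G ((l + k)%N :: ys)))
  else G [::].

Lemma le_runsmean ls (F G : seq nat -> R) : (forall ys, F ys <= G ys) ->
  runsmean ls F <= runsmean ls G.
Proof.
elim: ls F G => [|l ls IH] F G FG /=; first exact: FG.
by apply: le_binmean => // k _; apply: IH.
Qed.

Lemma runsmeanZ ls c (F : seq nat -> R) :
  runsmean ls (fun ys => c * F ys) = c * runsmean ls F.
Proof.
by elim: ls F => [|l ls IH] F //=; rewrite -binmeanZ; apply: eq_binmean => k _; exact: IH.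
Qed.

(** The output depends on the counts only through their totals over the input runs, and these totals
    are independent. *)
Lemma dupmean_runs b ls (F : seq bool -> R) :
  dupmean (sumn ls) (fun d => F (outstring (unruns b ls) d))
  = runsmean ls (fun ys => F (unruns b ys)).
Proof.
elim: ls b F => [|l ls IH] b F //=.
rewrite dupmean_cat -(dupmean_sumn l (fun s => runsmean ls (fun ys => F (unruns b (s :: ys))))).
apply: eq_dupmean => d1 sd1 /=; rewrite -(IH (~~ b) (fun z => F (nseq (sumn d1) b ++ z))).
by apply: eq_dupmean => d2 _; rewrite outstring_nseq_cat.
Qed.

(** * Change of measure to independent copies of Y^(q) *)

Section OutputLaw.
Variable q : R.
Hypothesis q01 : 0 < q < 1.

Let Q (y : nat) : R := y0 p q * weight p q y.

Let Q_gt0 y : 0 < Q y.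
Proof.
have /andP[q0 _] := q01.
by rewrite /Q weightE !mulr_gt0 ?y0_gt0 ?expR_gt0 ?exprn_gt0.
Qed.

(* The divergence D(P_{Y | x = l} || Y^(q)), which is affine in l. *)
Lemma run_divergence l :
  binmean p l (fun k => ln (binmass p l k) - ln (Q (l + k)))
  = - ln (y0 p q) - (1 + p) * l%:R * ln q.
Proof.
have /andP[q0 _] := q01.
rewrite (@eq_binmean _ _ _ _ (fun k => ln (binmass p l k) - (ln (y0 p q)
    + l%:R * ln q + ln q * k%:R + logweight p (l + k)))); last first.
  move=> k _; rewrite /Q weightE lnM ?posrE ?y0_gt0 ?mulr_gt0 ?expR_gt0 ?exprn_gt0 //.
  rewrite lnM ?posrE ?expR_gt0 ?exprn_gt0 // expRK lnXn // -[ln q *+ _]mulr_natr natrD.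
  by ring.
rewrite binmeanB binmeanD binmean_logweight // !binmeanD !binmean_cst binmeanZ binmean_nat.
by ring.
Qed.

(** The integral of [tau] against independent copies of Y^(q), restricted to the output lengths that
    input runs [ls] can produce. *)
Fixpoint runsweight (ls : seq nat) (tau : seq nat -> R) : R :=
  if ls is l :: ls' then
    \sum_(k < l.+1) Q (l + k) * runsweight ls' (fun ys => tau ((l + k)%N :: ys))
  else tau [::].

Lemma runsweight_gt0 ls tau : (forall ys, 0 < tau ys) -> 0 < runsweight ls tau.
Proof.
elim: ls tau => [|l ls IH] tau tau0 //=.
rewrite big_ord_recl ltr_pwDl //; first by rewrite mulr_gt0 // IH.
by rewrite sumr_ge0 // => k _; rewrite ltW // mulr_gt0 // IH.
Qed.

(* The log-sum inequality, from [ln u <= u - 1]. *)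
Lemma binmean_ln_le l (s : nat -> R) : (forall k, 0 < s k) ->
  binmean p l (fun k => ln (s k))
  <= - ln (y0 p q) - (1 + p) * l%:R * ln q + ln (\sum_(k < l.+1) Q (l + k) * s k).
Proof.
move=> s0; set S := \sum_(k < _) _.
have S0 : 0 < S.
  rewrite /S big_ord_recl ltr_pwDl //; first by rewrite mulr_gt0.
  by rewrite sumr_ge0 // => k _; rewrite ltW // mulr_gt0.
rewrite -run_divergence -(binmean_cst p l (ln S)) -binmeanD -subr_ge0 -binmeanB.
have B0 k : (k <= l)%N -> 0 < binmass p l k by exact: binmass_gt0.
apply: (@le_trans _ _ (binmean p l (fun k => 1 - Q (l + k) * s k / (S * binmass p l k)))).
  rewrite binmeanB binmean_cst /binmean.
  rewrite (eq_bigr (fun k : 'I_l.+1 => S^-1 * (Q (l + k) * s k))); last first.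
    move=> k _; have b0 : 0 < binmass p l k by apply: B0; rewrite -ltnS.
    by move: (Q _ * _) (binmass _ _ _) b0 => a b b0; field; rewrite !gt_eqF.
  by rewrite -mulr_sumr -/S mulVf ?subrr // gt_eqF.
apply: le_binmean => // k kl; have b0 := B0 k kl.
have qs0 : 0 < Q (l + k) * s k by exact: mulr_gt0.
have Sb0 : 0 < S * binmass p l k by exact: mulr_gt0.
have u0 : 0 < Q (l + k) * s k / (S * binmass p l k) by exact: divr_gt0.
have := @le_ln1Dx R (Q (l + k) * s k / (S * binmass p l k) - 1).
rewrite [1 + _]addrC subrK ltrBrDl subrr => /(_ u0).
have l1 : ln (Q (l + k) * s k) = ln (Q (l + k)) + ln (s k) by rewrite lnM ?posrE.
have l2 : ln (S * binmass p l k) = ln S + ln (binmass p l k) by rewrite lnM ?posrE.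
rewrite ln_div ?posrE // l1 l2.
by move: (ln _) (ln _) (ln _) (ln _) => *; lra.
Qed.

(** The variational bound E_P[ln tau] <= D(P || Q) + ln E_Q[tau], applied one run at a time; the
    divergences add up, and being affine in the run length they depend only on the number of runs
    and the total length. *)
Lemma runsmean_ln_le ls tau : (forall ys, 0 < tau ys) ->
  runsmean ls (fun ys => ln (tau ys))
  <= (size ls)%:R * - ln (y0 p q) - (1 + p) * (sumn ls)%:R * ln q + ln (runsweight ls tau).
Proof.
elim: ls tau => [|l ls IH] tau tau0 /=; first by rewrite mul0r mulr0 mul0r subrr add0r.
pose s k := runsweight ls (fun ys => tau ((l + k)%N :: ys)).
have s0 k : 0 < s k by apply: runsweight_gt0.
set c := (size ls)%:R * - ln (y0 p q) - (1 + p) * (sumn ls)%:R * ln q.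
apply: (@le_trans _ _ (binmean p l (fun k => c + ln (s k)))).
  by apply: le_binmean => // k _; apply: IH.
rewrite binmeanD binmean_cst; apply: (le_trans (lerD (lexx c) (binmean_ln_le l s0))).
by rewrite /c -natr1 natrD; rewrite le_eqVlt; apply/orP; left; apply/eqP; ring.
Qed.

Variable N : nat.

(** Unlike [runsweight], it depends on the codeword only through the number of runs, so it can be
    summed over messages. Lengths are truncated at N to keep the sums finite. *)
Fixpoint fullweight (r : nat) (tau : seq nat -> R) : R :=
  if r is r'.+1 then
    \sum_(y < N) Q y.+1 * fullweight r' (fun ys => tau (y.+1 :: ys))
  else tau [::].

Lemma fullweight_ge0 r tau : (forall ys, 0 <= tau ys) -> 0 <= fullweight r tau.
Proof.
elim: r tau => [|r IH] tau tau0 //=; rewrite sumr_ge0 // => y _.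
by rewrite mulr_ge0 ?(ltW (Q_gt0 _)) // IH.
Qed.

Lemma fullweight_le r tau c : 0 <= c -> (forall ys, tau ys <= c) ->
  fullweight r tau <= c.
Proof.
move=> c0; elim: r tau => [|r IH] tau tauc //=.
apply: (@le_trans _ _ (\sum_(y < N) Q y.+1 * c)).
  by apply: ler_sum => y _; rewrite ler_wpM2l ?(ltW (Q_gt0 _)) // IH.
rewrite -mulr_suml ler_piMl //; exact: sum_weight_le1.
Qed.

Lemma fullweight_sum M r (tau : 'I_M -> seq nat -> R) :
  \sum_(m < M) fullweight r (tau m) = fullweight r (fun ys => \sum_(m < M) tau m ys).
Proof.
elim: r tau => [|r IH] tau //=; rewrite exchange_big; apply: eq_bigr => y _ /=.
by rewrite -mulr_sumr IH.
Qed.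

(** Runs are nonempty, so every output length l + k lies between 1 and 2 l <= N, within the
    truncated support of Y^(q). *)
Lemma runsweight_le_full ls tau : all (leq 1) ls -> ((sumn ls).*2 <= N)%N ->
  (forall ys, 0 <= tau ys) -> runsweight ls tau <= fullweight (size ls) tau.
Proof.
elim: ls tau => [|l ls IH] tau //= /andP[l0 ls0] lN tau0.
have lsN : ((sumn ls).*2 <= N)%N by rewrite (leq_trans _ lN) // leq_double leq_addl.
have l2N : (l + l <= N)%N by rewrite addnn (leq_trans _ lN) // leq_double leq_addr.
pose h y := Q y * fullweight (size ls) (fun ys => tau (y :: ys)).
have h0 y : 0 <= h y by rewrite mulr_ge0 ?(ltW (Q_gt0 _)) ?fullweight_ge0.
apply: (@le_trans _ _ (\sum_(k < l.+1) h (l + k)%N)).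
  by apply: ler_sum => k _; rewrite ler_wpM2l ?(ltW (Q_gt0 _)) // IH.
have -> : \sum_(k < l.+1) h (l + k)%N = \sum_(l <= y < (l + l).+1) h y.
  have := @big_addn R 0 +%R 0 (l + l).+1 l xpredT h; rewrite add0n => ->.
  rewrite -addnS addKn big_mkord.
  by apply: eq_bigr => k _; rewrite addnC.
have -> : \sum_(y < N) Q y.+1 * fullweight (size ls) (fun ys => tau (y.+1 :: ys))
    = \sum_(1 <= y < N.+1) h y by rewrite big_add1 /= big_mkord.
rewrite [X in _ <= X](@big_cat_nat _ _ _ l) //=; last by rewrite ltnW // ltnS (leq_trans _ l2N) // leq_addr.
rewrite [X in _ <= _ + X](@big_cat_nat _ _ _ (l + l).+1) //=; last by rewrite (leq_trans _ (leqnSn _)) // leq_addr.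
have nn a b : 0 <= \sum_(a <= y < b) h y by apply: sumr_ge0.
by rewrite addrCA lerDl addr_ge0.
Qed.

End OutputLaw.

(* Fano's inequality in dual form: the number [rho] of runs, averaged over the
   messages, does not depend on q. *)
Lemma code_size_le n M (enc : 'I_M -> n.-tuple bool) (dec : seq bool -> 'I_M) (eps : R) :
  (0 < n)%N -> (0 < M)%N ->
  (avg_error_prob (duplication_dist p) enc dec <= eps%:E)%E ->
  exists2 rho : R, 0 < rho <= n%:R & forall q, 0 < q < 1 ->
    (1 - eps) * ln M%:R
    <= rho * - ln (y0 p q) - (1 + p) * n%:R * ln q + ln (4 * n.+1%:R).
Proof.
move=> n0 M0 herr; have M0' : (0 : R) < M%:R by rewrite ltr0n.
have n0' : (0 : R) < n.+1%:R by rewrite ltr0n.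
have runs (m : 'I_M) : exists bl : bool * seq nat, [/\ enc m = unruns bl.1 bl.2 :> seq bool,
    all (leq 1) bl.2, sumn bl.2 = n & (0 < size bl.2)%N].
  have [|b [ls [h1 h2 h3 h4]]] := @runsP (enc m); last first.
    by exists (b, ls); split => //; rewrite h3 size_tuple.
  by rewrite -size_eq0 size_tuple -lt0n.
have [bl hbl] := fin_all_exists runs.
pose rho := (\sum_(m < M) (size (bl m).2)%:R) / M%:R : R.
have rhoM : \sum_(m < M) (size (bl m).2)%:R = rho * M%:R by rewrite /rho divfK // gt_eqF.
pose good m ys : R := (dec (unruns (bl m).1 ys) == m)%:R.
pose cm m := runsmean (bl m).2 (good m).
have cmE m : cm m = dupmean n (fun d => (dec (outstring (enc m) d) == m)%:R).
  have [h1 _ h3 _] := hbl m.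
  by rewrite /cm /good -(dupmean_runs (bl m).1 (bl m).2 (fun z => (dec z == m)%:R)) h3 -h1.
have sum_cm : (1 - eps) * M%:R <= \sum_(m < M) cm m.
  have : ((\sum_(m < M) (1 - cm m))%:E <= eps%:E * M%:R%:E)%E.
    rewrite -lee_pdivrMr //; apply: le_trans herr.
    rewrite /avg_error_prob inver gt_eqF // lee_wpmul2r ?lee_fin ?invr_ge0 //.
    rewrite -sumEFin; apply: lee_sum => m _; rewrite cmE; exact: error_prob_ge.
  rewrite -EFinM lee_fin big_split /= sumr_const card_ord sumrN.
  by move: (\sum_(m < M) cm m) => s; rewrite mulrBl mul1r => ?; lra.
exists rho.
  rewrite /rho divr_gt0 //=; last first.
    rewrite (bigD1 (Ordinal M0)) //= ltr_pwDl ?sumr_ge0 //.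
    by rewrite ltr0n; have [] := hbl (Ordinal M0).
  rewrite ler_pdivrMr // mulr_natr -[X in _ *+ X]card_ord -sumr_const.
  apply: ler_sum => m _; have [_ h2 <- _] := hbl m.
  by rewrite ler_nat size_le_sumn.
move=> q q01.
(* ln tau is 0 on a decoding error and at least ln M otherwise, yet for a fixed output string the
   values of [tau] sum over m to only 2 M. *)
pose tau m ys : R := 1 + M%:R * good m ys.
have good0 m ys : 0 <= good m ys by [].
have tau0 m ys : 0 < tau m ys by rewrite ltr_pwDl // mulr_ge0.
pose S m := runsweight q (bl m).2 (tau m).
have S0 m : 0 < S m by apply: runsweight_gt0.
(* Two first bits, n + 1 values for the number of runs, and the 2 from the sum of [tau] over m. *)
pose c : R := 4 * n.+1%:R.
have c0 : 0 < c by rewrite mulr_gt0.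
have sumS : \sum_(m < M) S m <= c * M%:R.
  pose tau' b m ys : R := 1 + M%:R * (dec (unruns b ys) == m)%:R.
  have tau'0 b m ys : 0 <= tau' b m ys by rewrite addr_ge0 // mulr_ge0.
  pose FW b m r := fullweight q n.*2 r (tau' b m).
  have FW0 b m r : 0 <= FW b m r by apply: fullweight_ge0.
  apply: (@le_trans _ _ (\sum_(m < M) \sum_(b : bool) \sum_(r < n.+1) FW b m r)).
    apply: ler_sum => m _; have [_ h2 h3 _] := hbl m.
    rewrite (bigD1 (bl m).1) //=.
    have szn : (size (bl m).2 < n.+1)%N by rewrite ltnS -h3 size_le_sumn.
    rewrite (bigD1 (Ordinal szn)) //= -addrA.
    have h : S m <= FW (bl m).1 m (size (bl m).2).
      by apply: runsweight_le_full => // [|ys]; rewrite ?h3 // ltW.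
    apply: (le_trans h); rewrite lerDl addr_ge0 // sumr_ge0 // => b _.
    by rewrite sumr_ge0.
  rewrite exchange_big /=.
  apply: (@le_trans _ _ (\sum_(b : bool) \sum_(r < n.+1) 2 * M%:R)); last first.
    rewrite sumr_const card_bool sumr_const card_ord /c.
    by rewrite -mulr_natr -[_ *+ n.+1]mulr_natr; rewrite le_eqVlt; apply/orP; left; apply/eqP; ring.
  apply: ler_sum => b _; rewrite exchange_big /=; apply: ler_sum => r _.
  rewrite /FW fullweight_sum; apply: fullweight_le => // ys.
  rewrite /tau' big_split /= sumr_const card_ord -mulr_sumr.
  rewrite (bigD1 (dec (unruns b ys))) //= eqxx big1 ?addr0; last first.
    by move=> m; rewrite eq_sym => /negbTE ->.
  by rewrite le_eqVlt; apply/orP; left; apply/eqP; rewrite mulr1 -mulr_natl; ring.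
have step m : cm m * ln M%:R <= (size (bl m).2)%:R * - ln (y0 p q)
    - (1 + p) * n%:R * ln q + (S m / c - 1 + ln c).
  have [_ _ h3 _] := hbl m.
  apply: (@le_trans _ _ (runsmean (bl m).2 (fun ys => ln (tau m ys)))).
    rewrite mulrC /cm -runsmeanZ; apply: le_runsmean => ys.
    rewrite /tau /good; case: (_ == _); rewrite ?mulr1 ?mulr0 ?addr0 ?ln1 //.
    by rewrite ler_ln ?posrE ?addr_gt0 // lerDr.
  have := runsmean_ln_le q01 (bl m).2 (tau0 m); rewrite h3 => /le_trans; apply.
  rewrite lerD2l -/(S m).
  (* The tangent of ln at c takes the place of Jensen's inequality: summed over m, the terms S m / c
     - 1 are at most 0 by [sumS]. *)
  have u0 : 0 < S m / c by rewrite divr_gt0.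
  have := @le_ln1Dx R (S m / c - 1).
  rewrite [1 + _]addrC subrK ltrBrDl subrr => /(_ u0).
  by rewrite ln_div ?posrE // lerBlDr.
have : \sum_(m < M) cm m * ln M%:R <= \sum_(m < M) ((size (bl m).2)%:R * - ln (y0 p q)
    - (1 + p) * n%:R * ln q + (S m / c - 1 + ln c)) by apply: ler_sum.
have sumc (a : R) : \sum_(m < M) a = a * M%:R by rewrite sumr_const card_ord mulr_natr.
rewrite -mulr_suml !big_split /= -mulr_suml rhoM -mulr_suml !sumc.
have lnM0 : 0 <= ln M%:R :> R by rewrite ln_ge0 // ler1n.
have h1 := ler_wpM2r lnM0 sum_cm.
have h2 : (\sum_(m < M) S m) / c <= M%:R by rewrite ler_pdivrMr // mulrC.
move=> h3; rewrite -(ler_pM2r M0') -/c.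
apply: (@le_trans _ _ ((1 - eps) * M%:R * ln M%:R)); first by rewrite mulrAC.
apply: (le_trans h1); apply: (le_trans h3).
move: h2; set A := (\sum_(m < M) S m) / c => h2.
rewrite [leRHS](_ : _ = rho * M%:R * - ln (y0 p q) + - ((1 + p) * n%:R * ln q) * M%:R
  + (M%:R + -1 * M%:R + ln c * M%:R)); last by ring.
by rewrite lerD2l !lerD2r.
Qed.

End Channel.

(** * Capacity bounds *)

Section Rates.
Context {R : realType}.
Variable p : R.
Hypotheses (p_gt0 : 0 < p) (p_lt1 : p < 1).

Let run_capacity : \bar R :=
  ereal_sup [set (ereal_inf [set (- ln (y0 p q) - mu * ln q)%:E
                            | q in [set q : R | (0 < q < 1)%R]] / mu%:E)%E
            | mu in [set mu : R | (1 + p <= mu)%R]].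

Lemma ln_linear_near (e : R) : 0 < e ->
  \forall n \near \oo, ln (4 * n.+1%:R) <= e * n%:R.
Proof.
(* From ln u <= u - 1 at u = 4 a (n + 1): the slope 4 a = e / 2 leaves e n / 2 to absorb the
   constants. *)
move=> e0; pose a := e / 8; have a0 : 0 < a by rewrite divr_gt0.
near=> n.
have n0 : (0 : R) < 4 * n.+1%:R by rewrite mulr_gt0.
have h := @le_ln1Dx R (a * (4 * n.+1%:R) - 1).
move: h; rewrite [1 + _]addrC subrK ltrBrDl subrr => /(_ (mulr_gt0 a0 n0)).
rewrite lnM ?posrE // => h.
have hn : (e / 2 - 1 - ln a) / (e / 2) <= n%:R by near: n; exact: nbhs_infty_ger.
rewrite ler_pdivrMr ?divr_gt0 // in hn.
have h8 : a * (4 * n.+1%:R) = e / 2 * n%:R + e / 2 by rewrite /a -natr1; field.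
rewrite h8 in h; move: h hn; rewrite [n%:R * _]mulrC.
have -> : e * n%:R = e / 2 * n%:R + e / 2 * n%:R by field.
by move: (ln a) (e / 2 * n%:R) => *; lra.
Unshelve. all: by end_near. Qed.

Lemma achievable_rate_le (r : R) : achievable_rate (duplication_dist p) r ->
  (r%:E <= (1 + p)%:E * run_capacity)%E.
Proof.
move=> hr; have p1 : 0 < 1 + p by rewrite addr_gt0.
apply/lee_subgt0Pr => e e0.
(* Half of the slack e pays for the Fano loss eps r, the other half for ln (4 (n + 1)) / n; eps < 1
   keeps the factor 1 - eps positive. *)
pose eps := Num.min 2^-1 (e / (2 * (`|r| + 1))).
have r1 : 0 < 2 * (`|r| + 1) by rewrite mulr_gt0 // ltr_pwDr.
have eps0 : 0 < eps by rewrite lt_min invr_gt0 ltr0n divr_gt0.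
have eps1 : eps < 1 by rewrite gt_min invf_lt1 ?ltr1n.
have epsr : eps * r <= e / 2.
  have : eps * (2 * (`|r| + 1)) <= e by rewrite -ler_pdivlMr // ge_min lexx orbT.
  have := ler_wpM2l (ltW eps0) (ler_norm r).
  by rewrite mulrCA mulrDr mulr1; move: (eps * `|r|) => *; lra.
have e2 : 0 < e / 2 by rewrite divr_gt0.
have [n [n0 hln [M [enc [dec [hM herr]]]]]] : exists n, [/\ (0 < n)%N,
    ln (4 * n.+1%:R) <= e / 2 * n%:R & exists M (enc : 'I_M -> n.-tuple bool)
    (dec : seq bool -> 'I_M), expR (n%:R * r) <= M%:R /\
    (avg_error_prob (duplication_dist p) enc dec <= eps%:E)%E].
  have : \forall n \near \oo, [/\ (0 < n)%N,
    ln (4 * n.+1%:R) <= e / 2 * n%:R & exists M (enc : 'I_M -> n.-tuple bool)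
    (dec : seq bool -> 'I_M), expR (n%:R * r) <= M%:R /\
    (avg_error_prob (duplication_dist p) enc dec <= eps%:E)%E].
    near=> n; split; last by near: n; exact: hr.
      by near: n; exact: nbhs_infty_gt.
    by near: n; exact: ln_linear_near.
  by move=> [N _ hN]; exists N; apply: hN => /=.
have M0 : (0 < M)%N by rewrite -(ltr_nat R) (lt_le_trans _ hM) // expR_gt0.
have [rho /andP[rho0 rhon] hrho] := code_size_le p_gt0 p_lt1 n0 M0 herr.
have n0' : (0 : R) < n%:R by rewrite ltr0n.
pose mu := (1 + p) * n%:R / rho.
have mu0 : 0 < mu by rewrite divr_gt0 // mulr_gt0.
have mu1 : 1 + p <= mu.
  by rewrite /mu -mulrA ler_peMr ?(ltW p1) // ler_pdivlMr // mul1r.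
(* A lower bound for the bracket valid at every q at once, hence for its infimum; this uses that
   rho, and so mu, does not depend on q. *)
pose L := ((1 - eps) * (n%:R * r) - ln (4 * n.+1%:R)) / rho.
have hL q : 0 < q < 1 -> L <= - ln (y0 p q) - mu * ln q.
  move=> q01; rewrite /L ler_pdivrMr //.
  have -> : (- ln (y0 p q) - mu * ln q) * rho
      = rho * - ln (y0 p q) - (1 + p) * n%:R * ln q.
    by rewrite /mu; field; rewrite gt_eqF.
  rewrite lerBlDr (le_trans _ (hrho q q01)) //.
  rewrite ler_pM2l ?subr_gt0 // -ler_expR lnK ?posrE ?ltr0n //.
have hcap : ((L / mu)%:E <= run_capacity)%E.
  apply: le_trans (ereal_sup_ubound _); last by exists mu.
  rewrite EFinM inver gt_eqF // lee_wpmul2r ?lee_fin ?invr_ge0 ?(ltW mu0) //.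
  by apply: le_ereal_inf_tmp => _ [q /= q01 <-]; rewrite lee_fin hL.
rewrite -lee_pdivrMl // muleC; apply: le_trans hcap.
rewrite -EFinB -EFinM lee_fin ler_pdivrMr // mulrC.
rewrite /L /mu.
rewrite [leRHS](_ : _ = ((1 - eps) * (n%:R * r) - ln (4 * n.+1%:R)) / n%:R); last first.
  by field; rewrite !gt_eqF.
rewrite ler_pdivlMr // mulrBl mulrBl mul1r.
have h := ler_wpM2l (ltW n0') epsr.
move: h hln; rewrite mulrCA.
rewrite [e / 2 * _]mulrC (_ : e * n%:R = n%:R * (e / 2) + n%:R * (e / 2)); last by field.
by rewrite [r * _]mulrC; move: (n%:R * (e / 2)) (n%:R * r) => *; lra.
Unshelve. all: by end_near. Qed.

End Rates.

Theorem corollary9 (R : realType) (p : R) (hp0 : 0 < p) (hp1 : p < 1) :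
  let middle : \bar R :=
    ((1 + p)%:E *
     ereal_sup [set ereal_inf [set (- ln (y0 p q) - mu * ln q)%:E
                              | q in [set q : R | (0 < q < 1)%R]] / mu%:E
               | mu in [set mu : R | (1 + p <= mu)%R]])%E in
  let right : \bar R :=
    ereal_sup [set ((1 + p) * (- ln (y0 p q) - mean_Y p q * ln q)
                    / mean_Y p q)%:E
              | q in [set q : R | 0 < q < 1 /\ 1 + p <= mean_Y p q]] in
  (forall q : R, 0 < q < 1 -> (inv_y0 p q < +oo)%E) /\
  (Cap (duplication_dist p) <= middle)%E /\
  (middle <= right)%E.
Proof.
move=> middle right; have p1 : 0 < 1 + p by rewrite addr_gt0.
split; [|split].
- by move=> q q01; rewrite inv_y0E // ltry.
- by apply: ge_ereal_sup => _ [r /= hr <-]; exact: achievable_rate_le.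
- rewrite /middle -lee_pdivlMl //; apply: ge_ereal_sup => _ [mu /= hmu <-].
  have mu1 : 1 < mu by rewrite (lt_le_trans _ hmu) // ltrDl.
  have mu0 : 0 < mu by apply: lt_trans mu1.
  (* The infimum is at most its value at this one q, where the mean of Y^(q) is [mu]; optimality of
     q is not involved. *)
  have [q q01 hq] := mean_Y_surj hp0 hp1 mu1.
  rewrite lee_pdivlMl //; apply: (@le_trans _ _ ((1 + p) * (- ln (y0 p q) - mean_Y p q * ln q)
                    / mean_Y p q)%:E).
    rewrite hq -mulrA EFinM lee_wpmul2l ?lee_fin ?(ltW p1) //.
    rewrite EFinM inver gt_eqF // lee_wpmul2r ?lee_fin ?invr_ge0 ?(ltW mu0) //.
    by apply: ereal_inf_lbound; exists q.
  by apply: ereal_sup_ubound; exists q => //; split => //; rewrite hq.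
Qed.
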